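(* Let $\phi \in L^1(\mathbb{R}_+)$ with $\int_0^{\infty}\phi(x)\,dx = 1$ and $Z(\tilde{\phi}) = \emptyset$. Then for every $f \in L^{\infty}(\mathbb{R}_+)$ and every $\alpha$, \[\lim_{x\to\infty}\int_0^x f(t)\phi(x-t)\,dt = \alpha\] if and only if \[\lim_{x\to\infty}\int_x^{\infty} f(t)\phi(t-x)\,dt = \alpha.\] In other words, the summability methods $S_\phi$ and $S_\phi^*$ defined by these two limits are equivalent.
   Context: $\mathbb{R}_+ = [0,\infty)$ with Lebesgue measure; functions are complex-valued. $\tilde{\phi} \in L^1(\mathbb{R})$ equals $\phi$ on $[0,\infty)$ and $0$ on $(-\infty,0)$. For $g \in L^1(\mathbb{R})$, $\hat g(x) = \int_{-\infty}^\infty g(t)e^{-ixt}\,dt$ and $Z(g) = \{x \in \mathbb{R}: \hat g(x) = 0\}$. *)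

(* Defs.v *)
From mathcomp Require Import all_boot all_order all_algebra.
From mathcomp Require Import complex.
From mathcomp Require Import all_classical all_reals all_analysis.
Set Implicit Arguments. Unset Strict Implicit. Unset Printing Implicit Defensive.
Import Order.TTheory GRing.Theory Num.Theory.
Local Open Scope classical_set_scope.
Local Open Scope ring_scope.

Section Defs.
Variable R : realType.
Local Notation mu := (@lebesgue_measure R).
Local Notation C := (R[i]).

Definition cmod (z : C) : R := Num.sqrt (complex.Re z ^+ 2 + complex.Im z ^+ 2).

Definition Rplus : set R := `[0, +oo[%classic.

Definition Cintegral (D : set R) (f : R -> C) : C :=
  Complex (Rintegral mu D (fun t => complex.Re (f t)))
          (Rintegral mu D (fun t => complex.Im (f t))).

Definition CL1 (D : set R) (f : R -> C) : Prop :=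
  mu.-integrable D (fun t => (complex.Re (f t))%:E) /\
  mu.-integrable D (fun t => (complex.Im (f t))%:E).

Definition CLinf (D : set R) (f : R -> C) : Prop :=
  measurable_fun D (fun t => complex.Re (f t)) /\
  measurable_fun D (fun t => complex.Im (f t)) /\
  exists M : R, {ae mu, forall t, D t -> cmod (f t) <= M}.

Definition ext0 (phi : R -> C) : R -> C :=
  fun t => if (0 <= t) then phi t else 0.

Definition fourier (g : R -> C) (x : R) : C :=
  Cintegral setT (fun t => g t * Complex (cos (x * t)) (- sin (x * t))).

Definition Zset (g : R -> C) : set R := [set x | fourier g x = 0].

Definition Ccvg_pinfty (S : R -> C) (a : C) : Prop :=
  forall e : R, 0 < e -> exists M : R, forall x, M < x -> cmod (S x - a) < e.

Definition Sphi (phi f : R -> C) (x : R) : C :=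
  Cintegral `[0, x]%classic (fun t => f t * phi (x - t)).

Definition Sphistar (phi f : R -> C) (x : R) : C :=
  Cintegral `[x, +oo[%classic (fun t => f t * phi (t - x)).

End Defs.

(* Main.v *)
(** By extending [f] by [0] and subtracting [alpha], both limits say that a bounded
    function [g] on the line satisfies [g * k -> 0] at [+oo], for [k = phi] extended by
    [0] and for its reflection, whose Fourier transforms do not vanish either.  So it is
    enough to prove Wiener's Tauberian theorem: if [g * phi -> 0] then [g * k -> 0] for
    every [k] in [L1].

    Let [K] be a narrow Fejer kernel and [V] a de la Vallee-Poussin kernel with
    [V * K = K].  After modulation by [exp (- i c x)], the function [E := K * g] satisfies
    [E = V * E], so it is slowly varying and [phi * E] is close to [fourier phi c * E]:
    if [|E| <= M] eventually, then the difference is eventually at most [M] times a small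
    constant.  Since [phi * E = K * (phi * g) -> 0] and [fourier phi c <> 0], every
    eventual bound [M] improves to [3 / 4 * M], hence [E -> 0].  The width of [K] can be
    chosen uniformly for [c] in a compact interval, and wide Fejer kernels are
    combinations of modulated narrow ones; finally, the Fejer kernels form an approximate
    identity. *)

(* The difficulty in Wiener's theorem is the division by a Fourier transform, usually handled by
   local inversion in the algebra of such transforms. Here one divides only by a number, the value
   of the transform at a single frequency. The price is the error of freezing the transform near
   that frequency; the L1 translation modulus of the slowly varying kernel [V] controls it, and
   iterating a contraction absorbs it.

   Complex functions are carried as pairs of real ones: [p + i q] is the kernel and [g1 + i g2] the
   bounded function. Multiplication by [a + i b] then becomes a 2 by 2 real system of determinant
   [a ^+ 2 + b ^+ 2], and real kernels act on the two components separately.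

   All facts about the kernels come from [t ^+ 2 * fejer t = 1 - cos t], which turns trigonometric
   identities into identities between kernels off the null set [[set 0]]. Since [fejer] is by
   definition a superposition of cosines, Fubini plays the part of Fourier inversion.

   The constant [alpha] is subtracted on the whole line, also where the extended [f] is 0: kernels
   of mass 1 reproduce constants exactly, so no boundary term appears. *)
Require Import Defs.
From mathcomp Require Import all_boot all_order all_algebra.
From mathcomp Require Import complex.
From mathcomp Require Import all_classical all_reals all_analysis.
From mathcomp Require Import measurable_realfun ring lra.
Import Order.TTheory GRing.Theory Num.Theory.
Import numFieldNormedType.Exports.
Local Open Scope classical_set_scope.
Local Open Scope ring_scope.
Set Implicit Arguments. Unset Strict Implicit. Unset Printing Implicit Defensive.

(** * Affine changes of variable for Lebesgue measure *)

Section Affine.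
Variable R : realType.
Local Notation mu := (@lebesgue_measure R).

Lemma measurable_affine (a b : R) : measurable_fun setT (fun y : R => a * y + b).
Proof. by apply: measurable_funD => //; apply: measurable_funM. Qed.

(** By uniqueness of Lebesgue measure: the right-hand side is a measure in [A], so comparing lengths
    on half-open intervals suffices. For [a < 0] the preimage is closed on the other side, with the
    same length. *)
Lemma lebesgue_measure_affine (a b : R) (A : set R) : a != 0 -> measurable A ->
  mu A = (`|a|%:E * mu ((fun y : R => (a * y + b)%R) @^-1` A))%E.
Proof.
move=> a0 mA.
pose T : measurableTypeR R -> measurableTypeR R := fun y => (a * y + b : R).
have mT : measurable_fun setT T by exact: measurable_affine.
pose m : {measure set (measurableTypeR R) -> \bar R} :=
  mscale (NngNum (normr_ge0 a))
    (measure_function_pushforward__canonical__measure_function_Measure mu mT).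
suff mE X : ocitv X -> mu X = m X by rewrite (lebesgue_measure_unique mE).
move=> /ocitvP[->|]; first by rewrite !measure0.
move=> [[c d] /= cd ->].
rewrite (_ : m _ = (`|a|%:E * mu (T @^-1` `]c, d]))%E)//.
have [a1|a1] := ltP 0 a.
  have -> : T @^-1` `]c, d] = `](c - b) / a, (d - b) / a]%classic.
    by apply/seteqP; split => y /=; rewrite !in_itv /= /T ltr_pdivrMr// ler_pdivlMr//
      => /andP[h1 h2]; apply/andP; split; lra.
  rewrite !lebesgue_measure_itv /= !lte_fin cd ltr_pM2r ?invr_gt0// ltrD2r cd -!EFinB -EFinM gtr0_norm//.
  by congr EFin; field.
have {}a1 : a < 0 by rewrite lt_neqAle a0.
have -> : T @^-1` `]c, d] = `[(d - b) / a, (c - b) / a[%classic.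
  by apply/seteqP; split => y /=; rewrite !in_itv /= /T ltr_ndivlMr// ler_ndivrMr//
    => /andP[h1 h2]; apply/andP; split; lra.
rewrite !lebesgue_measure_itv /= !lte_fin cd ltr_nM2r ?invr_lt0// ltrD2r cd -!EFinB -EFinM ltr0_norm//.
by congr EFin; field.
Qed.

Lemma ge0_integral_affine (a b : R) (f : R -> \bar R) : a != 0 ->
  measurable_fun setT f -> (forall x, 0 <= f x)%E ->
  (\int[mu]_y f y = `|a|%:E * \int[mu]_y f (a * y + b)%R)%E.
Proof.
move=> a0 mf f0.
pose T : measurableTypeR R -> measurableTypeR R := fun y => (a * y + b : R).
have mT : measurable_fun setT T by exact: measurable_affine.
pose m : {measure set (measurableTypeR R) -> \bar R} :=
  mscale (NngNum (normr_ge0 a))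
    (measure_function_pushforward__canonical__measure_function_Measure mu mT).
rewrite (eq_measure_integral m) /=; last first.
  by move=> A mA _; exact: (lebesgue_measure_affine b a0 mA).
rewrite ge0_integral_mscale//=.
by rewrite ge0_integral_pushforward// preimage_setT.
Qed.

End Affine.

(** * Integrable real functions on the line, change of variable and Fubini *)

Section RealIntegral.
Variable R : realType.
Local Notation mu := (@lebesgue_measure R).
Implicit Types (k l f g F G : R -> R) (a b c x y t : R).

Definition L1 k := mu.-integrable setT (EFin \o k).

Lemma L1_measurable k : L1 k -> measurable_fun setT k.
Proof. by move=> /measurable_int /measurable_EFinP. Qed.

Lemma le_L1 k l : measurable_fun setT k -> (forall x, `|k x| <= l x) -> L1 l -> L1 k.
Proof.
move=> mk kl; apply: le_integrable => //; first exact/measurable_EFinP.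
by move=> x _ /=; rewrite lee_fin (le_trans (kl x))// ler_norm.
Qed.

Lemma eq_L1 k l : k =1 l -> L1 k -> L1 l.
Proof. by move=> /funext ->. Qed.

Lemma L1D k l : L1 k -> L1 l -> L1 (fun x => k x + l x).
Proof. by move=> k1 l1; exact: (integrableD measurableT k1 l1). Qed.

Lemma L1B k l : L1 k -> L1 l -> L1 (fun x => k x - l x).
Proof. by move=> k1 l1; exact: (integrableB measurableT k1 l1). Qed.

Lemma L1Z c k : L1 k -> L1 (fun x => c * k x).
Proof. by move=> k1; exact: (integrableZl measurableT c k1). Qed.

Lemma L1_norm k : L1 k -> L1 (fun x => `|k x|).
Proof. exact: integrable_norm. Qed.

Lemma L1_intT_fin k : L1 k -> (\int[mu]_x (k x)%:E)%E \is a fin_num.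
Proof. exact: (integrable_fin_num measurableT). Qed.

Lemma L1_mulr k G B : L1 k -> measurable_fun setT G -> (forall x, `|G x| <= B) ->
  L1 (fun x => k x * G x).
Proof.
move=> k1 mG GB; apply: (@le_L1 _ (fun x => B * `|k x|)).
- by apply: measurable_funM => //; exact: L1_measurable.
- by move=> x; rewrite normrM mulrC ler_wpM2r.
- exact/L1Z/L1_norm.
Qed.

Lemma L1_affine a b k : a != 0 -> L1 k -> L1 (fun x => k (a * x + b)).
Proof.
move=> a0 k1; have mk := L1_measurable k1.
have mk' : measurable_fun setT (fun x => k (a * x + b)).
  by apply: measurableT_comp => //; exact: measurable_affine.
apply/integrableP; split; first exact/measurable_EFinP.
have /integrableP[_] := k1.
rewrite (ge0_integral_affine b a0) => [||//]; last first.
  exact/measurableT_comp/measurable_EFinP.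
rewrite -[X in (_ * X)%E]/(\int[mu]_y `|(k (a * y + b))%:E|)%E.
(* A finite product with a positive factor forces the remaining integral to be finite. *)
have a1 : (0 < `|a|%:E)%E by rewrite lte_fin normr_gt0.
case: (integral _ _ _) => [r| |] //=.
- by move=> _; rewrite ltry.
- by rewrite gt0_muley.
Qed.

Lemma RintegralT_affine a b k : a != 0 -> L1 k ->
  \int[mu]_x k x = `|a| * \int[mu]_x k (a * x + b).
Proof.
move=> a0 k1; have mk := L1_measurable k1.
have k1' := L1_affine b a0 k1.
have mk' := L1_measurable k1'.
rewrite -[RHS]/(fine (`|a|%:E) * _) -fineM ?L1_intT_fin//; congr fine.
rewrite [LHS]integralE [in RHS]integralE muleBr//; last first.
  by rewrite fin_num_adde_defl// fin_numN integrable_neg_fin_num.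
rewrite (ge0_integral_affine b a0); last 2 first.
- exact/measurable_funepos/measurable_EFinP.
- by move=> x; exact: funepos_ge0.
rewrite [X in (_ - X)%E = _](ge0_integral_affine b a0)//; last first.
  exact/measurable_funeneg/measurable_EFinP.
by congr (_ * _ - _ * _)%E; apply: eq_integral => y _; rewrite !unlock.
Qed.

Lemma RintegralT_shift b k : L1 k -> \int[mu]_x k (x + b) = \int[mu]_x k x.
Proof.
move=> k1; rewrite (RintegralT_affine b (oner_neq0 R) k1) normr1 mul1r.
by apply: eq_Rintegral => x _; rewrite mul1r.
Qed.

Lemma RintegralT_reflect b k : L1 k -> \int[mu]_x k (b - x) = \int[mu]_x k x.
Proof.
move=> k1; rewrite (@RintegralT_affine (-1) b k)// ?oppr_eq0 ?oner_neq0//.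
rewrite normrN1 mul1r; apply: eq_Rintegral => x _.
by rewrite mulN1r addrC.
Qed.

Lemma L1_shift b k : L1 k -> L1 (fun x => k (x + b)).
Proof.
by move/(L1_affine b (oner_neq0 R)); apply: eq_L1 => x; rewrite mul1r.
Qed.

Lemma L1_reflect b k : L1 k -> L1 (fun x => k (b - x)).
Proof.
have N1 : (-1 : R) != 0 by rewrite oppr_eq0 oner_neq0.
by move/(L1_affine b N1); apply: eq_L1 => x; rewrite mulN1r addrC.
Qed.

Lemma RintegralT_ae_eq k l : {ae mu, forall x, k x = l x} ->
  measurable_fun setT k -> measurable_fun setT l ->
  \int[mu]_x k x = \int[mu]_x l x.
Proof.
move=> kl mk ml; congr fine; apply: ae_eq_integral => //.
- exact/measurable_EFinP.
- exact/measurable_EFinP.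
- by apply: (@filterS _ _ (ae_filter_ringOfSetsType mu)) kl => x /= ->.
Qed.

(** The majorant [h] of the inner norms gives integrability on the product by Tonelli. The third
    conclusion is an L1 bound for the other marginal; it later provides the constant of the
    contraction. *)
Lemma fubini_RintegralT (F : R * R -> R) h : measurable_fun setT F ->
  (forall x, L1 (fun y => F (x, y))) -> L1 h ->
  (forall x, \int[mu]_y `|F (x, y)| <= h x) ->
  [/\ L1 (fun x => \int[mu]_y F (x, y)), L1 (fun y => \int[mu]_x F (x, y)),
      \int[mu]_y `|\int[mu]_x F (x, y)| <= \int[mu]_x h x &
      \int[mu]_x \int[mu]_y F (x, y) = \int[mu]_y \int[mu]_x F (x, y)].
Proof.
move=> mF F1 h1 Fh.
have mE : measurable_fun setT (EFin \o F) by exact/measurable_EFinP.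
have mA : measurable_fun setT (abse \o (EFin \o F)) by exact: measurableT_comp.
have hle : (\int[mu]_x \int[mu]_y `|(F (x, y))%:E| <= \int[mu]_x (h x)%:E)%E.
  apply: ge0_le_integral => //.
  - by move=> x _; exact: integral_ge0.
  - exact: (measurable_fun_fubini_tonelli_F (m2 := mu) _ mA (fun _ => abse_ge0 _)).
  - exact: (measurable_int mu).
  - move=> x _; have := Fh x; rewrite -lee_fin; apply: le_trans.
    by rewrite fineK//; exact/L1_intT_fin/L1_norm.
have Fi : (mu \x mu)%E.-integrable setT (EFin \o F).
  apply/integrable12ltyP => //.
  by apply: le_lt_trans hle _; exact: integrable_lty.
have F2 := integrable_fubini_F Fi.
have mG : measurable_fun setT (fubini_G mu (EFin \o F)) by exact: (measurable_fubini_G Fi).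
have mG' : measurable_fun setT (fun y => \int[mu]_x F (x, y)).
  by apply: (measurableT_comp (fine_measurable measurableT)).
have Gfin : (\int[mu]_y `|(\int[mu]_x F (x, y))%:E| <= \int[mu]_x (h x)%:E)%E.
  apply: le_trans hle.
  rewrite (fubini_tonelli (m1 := mu) (m2 := mu) _ mA (fun _ => abse_ge0 _)).
  apply: ge0_le_integral => //.
  - by apply: measurableT_comp => //; exact/measurable_EFinP.
  - exact: (measurable_fun_fubini_tonelli_G (m1 := mu) _ mA (fun _ => abse_ge0 _)).
  (* [Rintegral] is the [fine] of an extended integral, hence 0 when that integral is infinite; the
     inequality holds in each case. *)
  - move=> y _; apply: (@le_trans _ _ `|\int[mu]_x (F (x, y))%:E|%E).
      rewrite /Rintegral.
      by case: (integral _ _ _) => [r| |] //=; rewrite normr0 leey.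
    apply: le_abse_integral => //.
    by apply: measurableT_comp => //; exact: measurableT_comp.
have L2 : L1 (fun y => \int[mu]_x F (x, y)).
  apply/integrableP; split; first exact/measurable_EFinP.
  by apply: le_lt_trans Gfin _; exact: integrable_lty.
split; [|exact: L2| |].
- have := F2; apply: eq_integrable => // x _.
  by rewrite /fubini_F /= fineK// L1_intT_fin.
- exact: (fine_le (L1_intT_fin (L1_norm L2)) (L1_intT_fin h1) Gfin).
- rewrite /Rintegral; congr fine.
  transitivity (\int[mu]_x (fubini_F mu (EFin \o F) x))%E.
    by apply: eq_integral => x _; rewrite fineK// L1_intT_fin.
  transitivity (\int[mu]_y (fubini_G mu (EFin \o F) y))%E; first exact: (Fubini Fi).
  (* Sections in [y] are integrable for every [x], but sections in [x] only for almost every [y], so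
     removing [fine] is legitimate only almost everywhere. *)
  apply: ae_eq_integral => //.
    exact/measurable_EFinP.
  apply: (@filterS _ _ (ae_filter_ringOfSetsType mu)) (ae_integrable2 Fi) => y Fy _.
  by rewrite /fubini_G /= fineK// (integrable_fin_num measurableT Fy).
Qed.

End RealIntegral.

(** * Convolution of an integrable kernel with a bounded function *)

Section Convolution.
Variable R : realType.
Local Notation mu := (@lebesgue_measure R).
Implicit Types (k l f g F G : R -> R) (a b c x y t : R).

Definition bounded_measurable G := measurable_fun setT G /\ exists B : R, forall x, `|G x| <= B.

(** Used with [k] integrable and [G] bounded, so that the integral converges at every [x] and not
    merely almost everywhere. *)
Definition conv k G x := \int[mu]_y (k y * G (x - y)).

Lemma measurable_sub x : measurable_fun setT (fun y : R => x - y).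
Proof. exact: measurable_funB. Qed.

Lemma bounded_measurable_sub G x :
  bounded_measurable G -> bounded_measurable (fun y => G (x - y)).
Proof.
move=> [mG [B GB]]; split; last by exists B.
by apply: measurableT_comp => //; exact: measurable_sub.
Qed.

Lemma bounded_measurableM F G : bounded_measurable F -> bounded_measurable G ->
  bounded_measurable (fun x => F x * G x).
Proof.
move=> [mF [A FA]] [mG [B GB]]; split; first exact: measurable_funM.
by exists (A * B) => x; rewrite normrM ler_pM.
Qed.

Lemma bounded_measurableD F G : bounded_measurable F -> bounded_measurable G ->
  bounded_measurable (fun x => F x + G x).
Proof.
move=> [mF [A FA]] [mG [B GB]]; split; first exact: measurable_funD.
by exists (A + B) => x; rewrite (le_trans (ler_normD _ _))// lerD.
Qed.

Lemma bounded_measurable_cst c : bounded_measurable (cst c).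
Proof. by split; [exact: measurable_cst | exists `|c| => x]. Qed.

Lemma L1M k G : L1 k -> bounded_measurable G -> L1 (fun y => k y * G y).
Proof. by move=> k1 [mG [B GB]]; exact: L1_mulr GB. Qed.

Lemma L1_conv k G x : L1 k -> bounded_measurable G -> L1 (fun y => k y * G (x - y)).
Proof. by move=> k1 /(bounded_measurable_sub x); exact: L1M. Qed.

Lemma normr_RintegralT k : L1 k -> `|\int[mu]_x k x| <= \int[mu]_x `|k x|.
Proof. exact: le_normr_Rintegral. Qed.

Lemma le_RintegralT k l : L1 k -> L1 l -> (forall x, k x <= l x) ->
  \int[mu]_x k x <= \int[mu]_x l x.
Proof. by move=> k1 l1 kl; apply: le_Rintegral. Qed.

Lemma le_RintegralM k G B : L1 k -> bounded_measurable G -> (forall x, `|G x| <= B) ->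
  `|\int[mu]_y (k y * G y)| <= B * \int[mu]_y `|k y|.
Proof.
move=> k1 bG GB; apply: le_trans (normr_RintegralT (L1M k1 bG)) _.
rewrite -RintegralZl//; last exact: L1_norm.
apply: le_RintegralT => [||x].
- exact/L1_norm/L1M.
- exact/L1Z/L1_norm.
- by rewrite normrM mulrC ler_wpM2r.
Qed.

Lemma convE k G x : L1 k -> bounded_measurable G ->
  conv k G x = \int[mu]_t (k (x - t) * G t).
Proof.
move=> k1 bG; rewrite /conv -(RintegralT_reflect x (L1_conv x k1 bG)).
by apply: eq_Rintegral => t _; rewrite subKr.
Qed.

Lemma measurable_conv_kernel k G : measurable_fun setT k -> measurable_fun setT G ->
  measurable_fun setT (fun z : R * R => k z.2 * G (z.1 - z.2)).
Proof.
move=> mk mG; apply: measurable_funM; first exact: measurableT_comp.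
by apply: measurableT_comp => //; exact: measurable_funB.
Qed.

(** The integrals of the positive and negative parts are measurable by Tonelli even where they are
    infinite, and [fine] is measurable; hence sections of any kind are allowed. *)
Lemma measurable_RintegralT (F : R * R -> R) : measurable_fun setT F ->
  measurable_fun setT (fun x => \int[mu]_y F (x, y)).
Proof.
move=> mF0; apply: (measurableT_comp (fine_measurable measurableT)).
have mF : measurable_fun setT (EFin \o F) by exact/measurable_EFinP.
have -> : (fun x => \int[mu]_y (F (x, y))%:E)%E =
    (fun x => fubini_F mu (EFin \o F)^\+%E x - fubini_F mu (EFin \o F)^\-%E x)%E.
  apply/funext => x; rewrite [LHS]integralE /fubini_F.
  by congr (_ - _)%E; apply: eq_integral => y _; rewrite !unlock.
apply: emeasurable_funB.
- apply: measurable_fun_fubini_tonelli_F => //; exact: measurable_funepos.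
- apply: measurable_fun_fubini_tonelli_F => //; exact: measurable_funeneg.
Qed.

Lemma bounded_measurable_conv k G : L1 k -> bounded_measurable G ->
  bounded_measurable (conv k G).
Proof.
move=> k1 bG; have [mG [B GB]] := bG; have mk := L1_measurable k1; split; last first.
  exists (B * \int[mu]_y `|k y|) => x; apply: le_RintegralM => //.
  exact: bounded_measurable_sub.
apply: (measurable_RintegralT (F := fun z => k z.2 * G (z.1 - z.2))).
exact: measurable_conv_kernel.
Qed.

(** Fubini with majorant [|l y|] times the L1 norm of [k] and a bound of [G]. This lets a smoothing
    kernel pass through a convolution whose limit is known. *)
Lemma conv_comm k l G x : L1 k -> L1 l -> bounded_measurable G ->
  conv l (conv k G) x = conv k (conv l G) x.
Proof.
move=> k1 l1 bG; have [mG [B GB]] := bG.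
have mk := L1_measurable k1; have ml := L1_measurable l1.
pose F (z : R * R) := l z.1 * (k z.2 * G (x - z.1 - z.2)).
have [|y||y|_ _ _ E] := @fubini_RintegralT _ F (fun y => `|l y| * (B * \int[mu]_t `|k t|)).
- apply: measurable_funM; first exact: measurableT_comp.
  apply: measurable_funM; first exact: measurableT_comp.
  apply: measurableT_comp => //; apply: measurable_funB => //.
  exact: measurable_funB.
- exact: (L1Z (l y) (L1_conv (x - y) k1 bG)).
- apply: (eq_L1 (k := fun y => (B * \int[mu]_t `|k t|) * `|l y|)) => [y|].
    by rewrite mulrC.
  exact/L1Z/L1_norm.
- rewrite /F /=; under eq_Rintegral do rewrite normrM.
  rewrite RintegralZl//; last exact/L1_norm/L1_conv.
  apply: ler_wpM2l => //; rewrite -RintegralZl//; last exact: L1_norm.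
  apply: le_RintegralT => [||t].
  + exact/L1_norm/L1_conv.
  + exact/L1Z/L1_norm.
  + by rewrite normrM mulrC ler_wpM2r.
transitivity (\int[mu]_y \int[mu]_t F (y, t)).
  by apply: eq_Rintegral => y _; rewrite -RintegralZl//; exact: L1_conv.
rewrite E; apply: eq_Rintegral => t _.
rewrite -RintegralZl//; last exact: L1_conv.
by apply: eq_Rintegral => y _; rewrite /F /= mulrCA addrAC.
Qed.

(** Boundedness of [k] makes [conv l k] defined at every point. One application of Fubini serves
    twice: with [G] equal to 1 it gives integrability, with a general [G] it gives associativity. *)
Lemma L1_conv2 k l : L1 k -> bounded_measurable k -> L1 l ->
  L1 (conv l k) /\
  forall G x, bounded_measurable G -> conv l (conv k G) x = conv (conv l k) G x.
Proof.
move=> k1 bk l1; have mk := L1_measurable k1; have ml := L1_measurable l1.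
pose h y := \int[mu]_t `|k t| * `|l y|.
have h1 : L1 h by exact/L1Z/L1_norm.
have fub G x : bounded_measurable G -> (exists2 B, 0 <= B & forall t, `|G t| <= B) ->
  L1 (fun t => conv l k t * G (x - t)) /\
  \int[mu]_s (l s * \int[mu]_t (k (t - s) * G (x - t))) = conv (conv l k) G x.
  move=> bG [B B0 GB]; have [mG _] := bG.
  have kG1 s : L1 (fun t => k (t - s) * G (x - t)).
    by apply: L1M; [exact: L1_shift|exact: bounded_measurable_sub].
  have [|y||y|_ L _ E] := @fubini_RintegralT _
      (fun z : R * R => l z.1 * (k (z.2 - z.1) * G (x - z.2))) (fun y => B * h y).
  - apply: measurable_funM; first exact: measurableT_comp.
    apply: measurable_funM; first by apply: measurableT_comp => //; exact: measurable_funB.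
    by apply: measurableT_comp => //; exact: measurable_funB.
  - exact: (L1Z (l y) (kG1 y)).
  - exact: L1Z.
  - rewrite /=; under eq_Rintegral do rewrite normrM.
    rewrite RintegralZl//; last exact: L1_norm.
    rewrite /h mulrA mulrC; apply: ler_wpM2r => //.
    rewrite -(RintegralT_shift (- y) (L1_norm k1)).
    rewrite -RintegralZl//; last exact/L1_norm/L1_shift.
    apply: le_RintegralT => [||t].
    + exact: L1_norm.
    + exact/L1Z/L1_norm/L1_shift.
    + by rewrite normrM mulrC ler_wpM2r.
  have inE t : \int[mu]_s (l s * (k (t - s) * G (x - t))) = conv l k t * G (x - t).
    rewrite /conv -RintegralZr//; last exact: L1_conv.
    by apply: eq_Rintegral => s _; rewrite mulrA.
  split; first by apply: eq_L1 L => t; exact: inE.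
  rewrite [RHS]/conv; under [RHS]eq_Rintegral do rewrite -inE.
  by rewrite -E; apply: eq_Rintegral => s _; rewrite -RintegralZl//; exact: kG1.
split.
  have [|L _] := fub (cst 1) 0 (bounded_measurable_cst 1).
    by exists 1 => // t; rewrite normr1.
  by apply: eq_L1 L => t /=; rewrite mulr1.
move=> G x bG; have [mG [B GB]] := bG.
have [|_ <-] := fub G x bG.
  by exists B => //; rewrite (le_trans _ (GB 0)).
apply: eq_Rintegral => s _; congr (_ * _).
rewrite /conv -(RintegralT_shift (- s) (L1_conv (x - s) k1 bG)).
by apply: eq_Rintegral => t _; congr (_ * G _); ring.
Qed.

End Convolution.

(** * Continuity of translation in L1 *)

Section TranslationModulus.
Variable R : realType.
Local Notation mu := (@lebesgue_measure R).
Implicit Types (k l f g F G : R -> R) (a b c x y t : R).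

Lemma dominated_RintegralT (f_ : nat -> R -> R) f g :
  (forall n, measurable_fun setT (f_ n)) -> measurable_fun setT f ->
  (forall x, f_ n x @[n --> \oo] --> f x) -> L1 g ->
  (forall n x, `|f_ n x| <= g x) ->
  \int[mu]_x f_ n x @[n --> \oo] --> \int[mu]_x f x.
Proof.
move=> mf_ mf ff g1 fg.
have f1 : L1 f.
  apply: le_L1 g1 => // x.
  have /cvg_norm fx := ff x.
  by apply: ler_cvg_to fx (cvg_cst (g x)) _; apply: nearW => n.
have [] := @dominated_convergence _ _ _ mu setT measurableT (fun n => EFin \o f_ n)
  (EFin \o f) (EFin \o g).
- by move=> n; apply/measurable_EFinP; exact: mf_.
- exact/measurable_EFinP.
- by apply/aeW => x _; apply: cvg_EFin; [exact: nearW|exact: ff].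
- exact: g1.
- by apply/aeW => x n _ /=; rewrite lee_fin.
move=> _ _ h; apply: fine_cvg.
by rewrite fineK//; exact: L1_intT_fin.
Qed.

Definition modulus k t := \int[mu]_s `|k (s - t) - k s|.

Lemma L1_shiftB k t : L1 k -> L1 (fun s => k (s - t) - k s).
Proof. by move=> k1; apply: L1B => //; exact: L1_shift. Qed.

Lemma modulus_ge0 k t : 0 <= modulus k t.
Proof. by apply: Rintegral_ge0 => s _. Qed.

Lemma modulus_le k t : L1 k -> modulus k t <= 2 * \int[mu]_s `|k s|.
Proof.
move=> k1; rewrite mulr_natl mulr2n -{1}(RintegralT_shift (- t) (L1_norm k1)).
rewrite -RintegralD//; [|exact/L1_norm/L1_shift|exact: L1_norm].
apply: le_RintegralT => [||s]; last exact: ler_normB.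
- exact/L1_norm/L1_shiftB.
- by apply: L1D; [exact/L1_norm/L1_shift|exact: L1_norm].
Qed.

Lemma modulusD_le k l t : L1 k -> L1 l ->
  modulus k t <= modulus l t + 2 * \int[mu]_s `|k s - l s|.
Proof.
move=> k1 l1; have kl := L1B k1 l1.
apply: le_trans (lerD (lexx _) (modulus_le t kl)).
rewrite -RintegralD//; [|exact/L1_norm/L1_shiftB|exact/L1_norm/L1_shiftB].
apply: le_RintegralT => [||s].
- exact/L1_norm/L1_shiftB.
- by apply: L1D; exact/L1_norm/L1_shiftB.
- rewrite [X in `|X|](_ : _ =
    (l (s - t) - l s) + (k (s - t) - l (s - t) - (k s - l s))); last ring.
  exact: ler_normD.
Qed.

Lemma measurable_modulus k : measurable_fun setT k -> measurable_fun setT (modulus k).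
Proof.
move=> mk; apply: (measurable_RintegralT (F := fun z => `|k (z.2 - z.1) - k z.2|)).
apply: measurableT_comp => //; apply: measurable_funB; last exact: measurableT_comp.
by apply: measurableT_comp => //; exact: measurable_funB.
Qed.

Lemma L1_indic_itv a b : L1 (\1_`[a, b] : R -> R).
Proof. exact: (integrable_indic_itv a b true false). Qed.

(** Dominated convergence: [G] is bounded, and since [t] is bounded all translates live on one
    compact interval, so a multiple of an indicator dominates. *)
Lemma modulus_cvg0_compact G N (t : nat -> R) : continuous G ->
  (forall s, N < `|s| -> G s = 0) -> t @ \oo --> 0 ->
  modulus G (t n) @[n --> \oo] --> 0.
Proof.
move=> cG G0 t0.
have mG : measurable_fun setT G by exact: continuous_measurable_fun.
have [M GM] : exists M : R, forall s, `|G s| <= M.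
  have [||c _ cM] := @EVT_max R (fun s => `|G s|) (- `|N|) `|N|.
  - by rewrite (@le_trans _ _ 0)// oppr_le0.
  - by apply: continuous_subspaceT => s; apply: cvg_norm; exact: cG.
  exists `|G c| => s; have [sN|sN] := leP `|s| `|N|.
    by apply: cM; rewrite in_itv /= -ler_norml.
  by rewrite G0 ?normr0// (le_lt_trans (ler_norm N)).
have [T tT] : exists T : R, forall n, `|t n| <= T.
  have /cvg_seq_bounded[T [_ Tt]] : cvgn t by apply/cvg_ex; exists 0.
  by exists (T + 1) => n; apply: Tt => //; rewrite ltrDl.
rewrite [X in _ --> X](_ : _ = \int[mu]_s (cst 0 s)); last first.
  by rewrite /Rintegral integral0.
apply: (@dominated_RintegralT _ _
    (fun s => (2 * M) * \1_`[- (N + T), N + T] s)) => [n||s||n s].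
- apply: measurableT_comp => //; apply: measurable_funB => //.
  by apply: measurableT_comp => //; exact: measurable_funB.
- exact: measurable_cst.
- rewrite [X in _ --> X](_ : _ = `|G (s - 0) - G s|); last by rewrite subr0 subrr normr0.
  apply: cvg_norm; apply: cvgB; last exact: cvg_cst.
  apply: continuous_cvg; first exact: cG.
  by apply: cvgB; [exact: cvg_cst|exact: t0].
- exact/L1Z/L1_indic_itv.
- rewrite normr_id indicE.
  have [sI|sI] := boolP (s \in `[- (N + T), N + T]%classic).
    rewrite mulr1 mulr_natl mulr2n (le_trans (ler_normB _ _))// lerD//.
  have sNT : N + T < `|s|.
    rewrite ltNge; apply: contra sI => sNT.
    by rewrite inE /= in_itv /= -ler_norml.
  have T0 : 0 <= T by exact: le_trans (tT 0%N).
  rewrite !G0 ?subr0 ?normr0 ?mulr0//; first by rewrite (le_lt_trans _ sNT)// lerDl.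
  have := ler_normD (s - t n) (t n); rewrite subrK => h.
  by have := tT n; lra.
Qed.

Definition tent n x : R := Num.max (1 - `|x| / n.+1%:R) 0.

Lemma tent_bounds n x : 0 <= tent n x <= 1.
Proof.
rewrite /tent le_max lexx orbT /= ge_max ler01 andbT.
by rewrite gerBl divr_ge0.
Qed.

Lemma tent_continuous n : continuous (tent n).
Proof.
move=> x; apply: (@continuous_max _ _ (fun x => 1 - `|x| / n.+1%:R) (cst 0)).
  apply: cvgB; first exact: cvg_cst.
  by apply: cvgM; [apply: cvg_norm; exact: cvg_id|exact: cvg_cst].
exact: cvg_cst.
Qed.

Lemma tent_eq0 n x : n.+1%:R < `|x| -> tent n x = 0.
Proof.
move=> nx; rewrite /tent; apply/max_idPr.
by rewrite subr_le0 ler_pdivlMr// mul1r ltW.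
Qed.

Lemma tent_cvg1 x : tent n x @[n --> \oo] --> (1 : R).
Proof.
apply: (@squeeze_cvgr _ _ _ _ (fun n => 1 - `|x| * n.+1%:R^-1) (cst 1)).
- by apply: nearW => n; rewrite /tent le_max lexx /=; have /andP[] := tent_bounds n x.
- rewrite -[X in _ --> X]subr0 -[X in _ --> _ - X](mulr0 `|x|).
  apply: cvgB; first exact: cvg_cst.
  by apply: cvgM; [exact: cvg_cst|exact: cvg_harmonic].
- exact: cvg_cst.
Qed.

(** Half of [e] is spent on multiplying [k] by a wide tent, the other half on approximating [k] by a
    continuous function on the support of that tent. Multiplying this function by the tent makes it
    continuous and zero outside the interval. *)
Lemma L1_compact_approx k e : L1 k -> 0 < e ->
  exists (G : R -> R) (N : R), [/\ continuous G, forall s, N < `|s| -> G s = 0, L1 G &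
    \int[mu]_s `|k s - G s| <= e].
Proof.
move=> k1 e0; have mk := L1_measurable k1.
have mtent n : measurable_fun setT (tent n).
  by apply: continuous_measurable_fun; exact: tent_continuous.
have ktent1 n : L1 (fun s => k s * tent n s).
  apply: (L1_mulr (B := 1) k1 (mtent n)) => x.
  by have /andP[h0 h1] := tent_bounds n x; rewrite ger0_norm.
have /cvgr0Pnorm_le /(_ (e / 2)) : \int[mu]_s `|k s - k s * tent n s| @[n --> \oo] --> 0.
  rewrite [X in _ --> X](_ : _ = \int[mu]_s (cst 0 s)); last first.
    by rewrite /Rintegral integral0.
  apply: (@dominated_RintegralT _ _ (fun s => `|k s|)) => [n||s||n s].
  - apply: measurableT_comp => //; apply: measurable_funB => //.
    exact: measurable_funM.
  - exact: measurable_cst.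
  - rewrite [X in _ --> X](_ : _ = `|k s - k s * 1|); last by rewrite mulr1 subrr normr0.
    apply: cvg_norm; apply: cvgB; first exact: cvg_cst.
    by apply: cvgM; [exact: cvg_cst|exact: tent_cvg1].
  - exact: L1_norm.
  - rewrite normr_id -{1}(mulr1 (k s)) -mulrBr normrM ler_piMr//.
    by have /andP[h0 h1] := tent_bounds n s; rewrite ger0_norm ?subr_ge0// gerBl.
rewrite divr_gt0// => /(_ isT)[n _ /(_ n (leqnn n)) /= hn].
pose E := `[- n.+1%:R, n.+1%:R]%classic : set R.
have mE : measurable E by exact: measurable_itv.
have muE : (mu E < +oo)%E by rewrite lebesgue_measure_itv /=; case: ifP => _; rewrite ltry.
have kE : mu.-integrable E (EFin \o k) by exact: integrableS k1.
have [g [cg g1 gk]] := approximation_continuous_integrable mE muE kE.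
have /fine_cvgP[_ /cvgr0Pnorm_le /(_ (e / 2))] := gk.
rewrite divr_gt0// => /(_ isT)[m _ /(_ m (leqnn m)) /= hm].
have cG : continuous (fun s => g m s * tent n s).
  by move=> s; apply: cvgM; [exact: cg|exact: tent_continuous].
have G1 : L1 (fun s => g m s * tent n s).
  apply: (@le_L1 _ _ (fun s => `|(g m \_ E) s|)).
  - exact: continuous_measurable_fun.
  - move=> s; rewrite patchE; case: ifPn => sE.
      by rewrite normrM ler_piMr//; have /andP[h0 h1] := tent_bounds n s; rewrite ger0_norm.
    rewrite tent_eq0 ?mulr0 ?normr0// ltNge; apply: contra sE => sE.
    by rewrite inE /E /= in_itv /= -ler_norml.
  - apply: L1_norm; rewrite /L1.
    have h := (integrable_mkcond (mu := mu) (EFin \o g m) mE).1 (g1 m).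
    by rewrite -restrict_EFin; exact: h.
exists (fun s => g m s * tent n s), n.+1%:R; split => //.
  by move=> s ns; rewrite tent_eq0// mulr0.
rewrite ger0_norm in hn; last by apply: Rintegral_ge0.
have kg1 : L1 (fun s => (k s - g m s) * tent n s).
  by apply: eq_L1 (L1B (ktent1 n) G1) => s; rewrite mulrBl.
apply: (@le_trans _ _ (\int[mu]_s `|k s - k s * tent n s| +
   \int[mu]_s `|(k s - g m s) * tent n s|)).
  rewrite -RintegralD//; [|exact/L1_norm/L1B|exact: L1_norm].
  apply: le_RintegralT => [||s].
  - exact/L1_norm/L1B.
  - by apply: L1D; apply: L1_norm => //; exact: L1B.
  - rewrite [X in `|X|](_ : _ = (k s - k s * tent n s) + (k s - g m s) * tent n s); last ring.
    exact: ler_normD.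
rewrite (splitr e) lerD//.
apply: le_trans (le_trans (ler_norm _) hm).
have kgE : mu.-integrable E (EFin \o (fun s => `|k s - g m s|)).
  by apply: integrable_norm; exact: (integrableB (mu := mu) mE kE (g1 m)).
rewrite -[leRHS]/(\int[mu]_(s in E) `|k s - g m s|) [leRHS]Rintegral_mkcond.
apply: le_RintegralT => [||s].
- exact: L1_norm.
- have h := (integrable_mkcond (mu := mu) _ mE).1 kgE.
  by rewrite /L1 -restrict_EFin; exact: h.
- rewrite patchE; case: ifPn => sE.
    by rewrite normrM ler_piMr//; have /andP[h0 h1] := tent_bounds n s; rewrite ger0_norm.
  rewrite tent_eq0 ?mulr0 ?normr0// ltNge; apply: contra sE => sE.
  by rewrite inE /E /= in_itv /= -ler_norml.
Qed.

Lemma modulus_cvg0 k (t : nat -> R) : L1 k -> t @ \oo --> 0 ->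
  modulus k (t n) @[n --> \oo] --> 0.
Proof.
move=> k1 t0; apply/cvgr0Pnorm_le => e e0.
(* The approximation error enters [modulusD_le] with a factor 2: [e / 4 + 2 * (e / 4) <= e]. *)
have e4 : 0 < e / 4 by rewrite divr_gt0.
have [G [N [cG GN G1 kG]]] := L1_compact_approx k1 e4.
have /cvgr0Pnorm_le /(_ _ e4) := modulus_cvg0_compact cG GN t0.
apply: filterS => n; rewrite !ger0_norm ?modulus_ge0// => h.
have := modulusD_le (t n) k1 G1; lra.
Qed.

(** Serves two purposes. With [k] a de la Vallee-Poussin kernel it makes the contraction error small
    after stretching that kernel; with [p] the Fejer kernel it says that its dilations are an
    approximate identity. *)
Lemma modulus_average_cvg0 p k : L1 p -> L1 k ->
  \int[mu]_y (`|p y| * modulus k (y / n.+1%:R)) @[n --> \oo] --> 0.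
Proof.
move=> p1 k1; have mk := L1_measurable k1; have mp := L1_measurable p1.
rewrite [X in _ --> X](_ : _ = \int[mu]_s (cst 0 s)); last first.
  by rewrite /Rintegral integral0.
apply: (@dominated_RintegralT _ _
    (fun y => (2 * \int[mu]_s `|k s|) * `|p y|)) => [n||y||n y].
- apply: measurable_funM; first exact: measurableT_comp.
  apply: (measurableT_comp (measurable_modulus mk)).
  exact: measurable_funM.
- exact: measurable_cst.
- rewrite [X in _ --> X](_ : _ = `|p y| * 0); last by rewrite mulr0.
  apply: cvgM; first exact: cvg_cst.
  apply: modulus_cvg0 => //.
  by rewrite -[X in _ --> X](mulr0 y); apply: cvgM; [exact: cvg_cst|exact: cvg_harmonic].
- exact/L1Z/L1_norm.
- rewrite ger0_norm ?mulr_ge0 ?modulus_ge0// mulrC ler_wpM2r//.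
  exact: modulus_le.
Qed.

End TranslationModulus.

(** * The Fejer and de la Vallee-Poussin kernels *)

Section FejerKernel.
Variable R : realType.
Local Notation mu := (@lebesgue_measure R).
Implicit Types (k l f g F G : R -> R) (a b c x y t : R).

Lemma measurable_cos : measurable_fun setT (@cos R).
Proof. by apply: continuous_measurable_fun; exact: continuous_cos. Qed.

Lemma measurable_sin : measurable_fun setT (@sin R).
Proof. by apply: continuous_measurable_fun; exact: continuous_sin. Qed.

Lemma bounded_measurable_cos a : bounded_measurable (fun x => cos (a * x)).
Proof.
split; first by apply: (measurableT_comp measurable_cos); exact: measurable_funM.
by exists 1 => x; exact: cos_max.
Qed.

Lemma bounded_measurable_sin a : bounded_measurable (fun x => sin (a * x)).
Proof.
split; first by apply: (measurableT_comp measurable_sin); exact: measurable_funM.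
by exists 1 => x; exact: sin_max.
Qed.

Lemma L1_oneDsqrV : L1 (fun x => (oneDsqr x)^-1).
Proof.
have cf : continuous (fun x : R => (oneDsqr x)^-1) by exact: continuous_oneDsqrV.
apply/integrableP; split.
  by apply/measurable_EFinP; exact: continuous_measurable_fun.
under eq_integral do rewrite /= ger0_norm ?invr_ge0 ?oneDsqr_ge0//.
rewrite ge0_symfun_integralT//=.
- by rewrite -set_itvcy integral0y_oneDsqr -EFinM ltry.
- by move=> x; rewrite /= /oneDsqr sqrrN.
Qed.

(** Right half of the triangle on [[-1, 1]]: the triangle is even, so its cosine transform is
    determined by this half, and the integration by parts runs over a single interval. *)
Definition fejer_weight x : R := (1 - x) * \1_`[0, 1] x.

Lemma fejer_weight_ge0 x : 0 <= fejer_weight x.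
Proof.
rewrite /fejer_weight indicE; have [|_] := boolP (x \in _); last by rewrite mulr0.
by rewrite inE /= in_itv /= => /andP[_ x1]; rewrite mulr1 subr_ge0.
Qed.

Lemma fejer_weight_eq0 x : 1 < `|x| -> fejer_weight x = 0.
Proof.
move=> x1; rewrite /fejer_weight indicE; have [|_] := boolP (x \in _); last by rewrite mulr0.
rewrite inE /= in_itv /= => /andP[x0]; move: x1; rewrite ger0_norm// => x1.
by rewrite leNgt x1.
Qed.

Lemma L1_fejer_weight : L1 fejer_weight.
Proof.
apply: (le_L1 (l := \1_`[0, 1])); last exact: L1_indic_itv.
  by apply: measurable_funM => //; exact: measurable_funB.
move=> x; rewrite ger0_norm ?fejer_weight_ge0// /fejer_weight indicE.
have [|_] := boolP (x \in _); last by rewrite mulr0.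
by rewrite inE /= in_itv /= => /andP[x0 _]; rewrite mulr1 gerBl.
Qed.

(* The Fourier transform of the triangle (1 - |x|)+, up to the factor 2. *)
Definition fejer t := \int[mu]_x (fejer_weight x * cos (x * t)).

Lemma L1_fejer_weight_cos t : L1 (fun x => fejer_weight x * cos (x * t)).
Proof.
apply: L1M; first exact: L1_fejer_weight.
by under eq_fun do rewrite mulrC; exact: bounded_measurable_cos.
Qed.

Lemma fejerN t : fejer (- t) = fejer t.
Proof. by apply: eq_Rintegral => x _; rewrite mulrN cosN. Qed.

(** Integration by parts, written without division so that it holds at [t = 0] too. The function [F]
    below is the explicit antiderivative. *)
Lemma sqr_fejer t : t ^+ 2 * fejer t = 1 - cos t.
Proof.
have [->|t0] := eqVneq t 0; first by rewrite expr0n mul0r cos0 subrr.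
have -> : fejer t = \int[mu]_(x in `[0, 1]) ((1 - x) * cos (x * t)).
  rewrite [RHS]Rintegral_mkcond; apply: eq_Rintegral => x _.
  rewrite /fejer_weight patchE indicE; case: ifP => _ /=; first by rewrite mulr1.
  by rewrite mulr0 mul0r.
pose F x := (1 - x) * sin (x * t) / t - cos (x * t) / t ^+ 2.
have dF x : is_derive x 1 F ((1 - x) * cos (x * t)).
  rewrite /F; apply: is_derive_eq.
  rewrite /GRing.scale /= !(mulr0, mulr1, add0r, addr0, mul0r, subr0, sub0r, oppr0, scaler0).
  by field.
have cF : continuous F.
  by move=> x; apply: differentiable_continuous; apply/derivable1_diffP; exact: ex_derive.
rewrite /Rintegral (@continuous_FTC2 _ _ F)//.
- rewrite -EFinB /= /F; rewrite !mul1r !mul0r subrr subr0 mul0r mul0r cos0 sin0 mulr0 mul0r.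
  by field.
- apply: continuous_subspaceT => x; apply: cvgM.
    by apply: cvgB; [exact: cvg_cst|exact: cvg_id].
  apply: continuous_cvg; first exact: continuous_cos.
  by apply: cvgM; [exact: cvg_id|exact: cvg_cst].
- split.
  + by move=> x _; exact: ex_derive.
  + by apply: cvg_at_right_filter; exact: cF.
  + by apply: cvg_at_left_filter; exact: cF.
- by move=> x _; rewrite derive1E; exact: derive_val.
Qed.

Lemma fejer_ge0 t : 0 <= fejer t.
Proof.
have [->|t0] := eqVneq t 0.
  by apply: Rintegral_ge0 => x _; rewrite mulr0 cos0 mulr1 fejer_weight_ge0.
rewrite -(pmulr_rge0 _ (_ : 0 < t ^+ 2)) ?sqr_fejer ?subr_ge0 ?cos_le1//.
by rewrite exprn_even_gt0.
Qed.

Lemma fejer_le t : fejer t <= \int[mu]_x fejer_weight x.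
Proof.
apply: le_RintegralT => [||x].
- exact: L1_fejer_weight_cos.
- exact: L1_fejer_weight.
- by rewrite ler_piMr ?fejer_weight_ge0// cos_le1.
Qed.

Lemma measurable_fejer : measurable_fun setT fejer.
Proof.
apply: (measurable_RintegralT (F := fun z => fejer_weight z.2 * cos (z.2 * z.1))).
apply: measurable_funM.
  apply: measurableT_comp => //; apply: L1_measurable; exact: L1_fejer_weight.
by apply: (measurableT_comp measurable_cos); exact: measurable_funM.
Qed.

Lemma bounded_measurable_fejer : bounded_measurable fejer.
Proof.
split; first exact: measurable_fejer.
by exists (\int[mu]_x fejer_weight x) => x; rewrite ger0_norm ?fejer_ge0// fejer_le.
Qed.

(** Adding the bounds [fejer t <= fejer 0] and [t ^+ 2 * fejer t <= 2] gives decay like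
    [(1 + t ^+ 2)^-1]. *)
Lemma L1_fejer : L1 fejer.
Proof.
apply: (le_L1 (l := fun t => (2 + \int[mu]_x fejer_weight x) * (oneDsqr t)^-1)).
- exact: measurable_fejer.
- move=> t; rewrite ger0_norm ?fejer_ge0// ler_pdivlMr ?oneDsqr_gt0//.
  rewrite /oneDsqr mulrDr mulr1 addrC lerD ?fejer_le// mulrC sqr_fejer.
  by rewrite lerBlDr -[leRHS]/(1 + 1 + cos t) -addrA lerDl -lerBlDl sub0r cos_geN1.
- exact/L1Z/L1_oneDsqrV.
Qed.

(** The value is pi; it is kept as a symbol whose positivity allows division. *)
Definition fejer_mass : R := \int[mu]_t fejer t.

(** On [[1, 2]], inside [[0, pi]] where the cosine decreases, [4 * fejer t >= t ^+ 2 * fejer t >= 1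
    - cos 1]; elsewhere [fejer] is nonnegative. *)
Lemma fejer_mass_gt0 : 0 < fejer_mass.
Proof.
have pi2 : (2 : R) <= pi by exact: pi_ge2.
have c1 : cos 1 < 1 :> R.
  by rewrite -[ltRHS]cos0 ltr_cos ?in_itv /= ?lexx ?ler01 ?pi_ge0//=; lra.
apply: (@lt_le_trans _ _ (\int[mu]_t ((1 - cos 1) / 4 * \1_`[1, 2] t))).
  rewrite RintegralZl//; last exact: L1_indic_itv.
  rewrite mulr_gt0 ?divr_gt0 ?subr_gt0//.
  have mu12 : mu (`[1, 2]%classic : set R) = 1%:E.
    by rewrite lebesgue_measure_itv /= lte_fin ltr1n /= -EFinB; congr EFin; lra.
  suff -> : \int[mu]_t \1_`[1, 2] t = 1 :> R by [].
  by rewrite /Rintegral integral_indic// setIT; exact: (congr1 fine mu12).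
apply: le_RintegralT => [||t].
- exact/L1Z/L1_indic_itv.
- exact: L1_fejer.
- rewrite indicE; have [|_] := boolP (t \in _); last by rewrite mulr0 fejer_ge0.
  rewrite inE /= in_itv /= => /andP[t1 t2]; rewrite mulr1.
  have ct : cos t <= cos 1.
    by rewrite leNgt ltr_cos ?in_itv /= -?leNgt//; apply/andP; split; lra.
  have := sqr_fejer t; have := fejer_ge0 t => f0 ft.
  have : t ^+ 2 * fejer t <= 4 * fejer t by apply: ler_wpM2r => //; nra.
  rewrite ft ler_pdivrMr//; lra.
Qed.

(** The factor [a ^+ 2] is chosen because [t ^+ 2 * (a ^+ 2 * fejer (a * t))] is [1 - cos (a * t)].
    The degenerate case [a = 0] does occur: frequencies [1 + x] and [1 - x] appear below with [x] at
    the ends of [[-1, 1]]. *)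
Lemma RintegralT_sqr_scale k a : L1 k ->
  \int[mu]_t (a ^+ 2 * k (a * t)) = `|a| * \int[mu]_t k t.
Proof.
move=> k1; have [->|a0] := eqVneq a 0.
  rewrite normr0 mul0r; under eq_Rintegral do rewrite expr0n mul0r.
  by rewrite /Rintegral integral0.
have ka1 : L1 (fun t => k (a * t)).
  by apply: eq_L1 (L1_affine 0 a0 k1) => t; rewrite addr0.
rewrite RintegralZl// (RintegralT_affine 0 a0 k1).
rewrite mulrA -expr2 real_normK ?num_real//.
by congr (_ * _); apply: eq_Rintegral => t _; rewrite addr0.
Qed.

Lemma RintegralT_fejer a :
  \int[mu]_t (a ^+ 2 * fejer (a * t)) = `|a| * fejer_mass.
Proof. exact/RintegralT_sqr_scale/L1_fejer. Qed.

Lemma L1_fejerZ a : L1 (fun t => a ^+ 2 * fejer (a * t)).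
Proof.
have [->|a0] := eqVneq a 0.
  apply: (eq_L1 (k := fun t => 0 * fejer t)); last exact/L1Z/L1_fejer.
  by move=> t; rewrite expr0n /= !mul0r.
by apply: L1Z; apply: eq_L1 (L1_affine 0 a0 L1_fejer) => t; rewrite addr0.
Qed.

(* The de la Vallee-Poussin kernel: its Fourier transform is 1 on [-1, 1]. *)
Definition vallee_poussin t := fejer_mass^-1 * (2 ^+ 2 * fejer (2 * t) - 1 ^+ 2 * fejer (1 * t)).

Lemma L1_vallee_poussin : L1 vallee_poussin.
Proof. by apply: L1Z; apply: L1B; exact: L1_fejerZ. Qed.

Lemma vallee_poussinN t : vallee_poussin (- t) = vallee_poussin t.
Proof. by rewrite /vallee_poussin !mulrN !fejerN. Qed.

(** Product-to-sum formulas turn the integrand into a combination of scaled Fejer kernels, whose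
    masses are proportional to the absolute values of their scales. For [|x| <= 1] these add up to
    [(2 + x) + (2 - x) - (1 + x) - (1 - x) = 2]. *)
Lemma vallee_poussin_cos x : `|x| <= 1 ->
  \int[mu]_t (vallee_poussin t * cos (x * t)) = 1.
Proof.
rewrite ler_norml => /andP[x1 x2].
pose c a t := a ^+ 2 * fejer (a * t).
have c1 a : L1 (c a) by exact: L1_fejerZ.
have cs a b : L1 (fun t => c a t + c b t) by exact: L1D.
have C0 := lt0r_neq0 fejer_mass_gt0.
transitivity (\int[mu]_t ((2 * fejer_mass)^-1 *
    ((c (2 + x) t + c (2 - x) t) - (c (1 + x) t + c (1 - x) t)))).
  apply: RintegralT_ae_eq; last 2 first.
  - apply: L1_measurable; apply: L1M; first exact: L1_vallee_poussin.
    exact: bounded_measurable_cos.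
  - by apply: L1_measurable; apply: L1Z; apply: L1B.
  (* The kernel identity is checked after multiplication by [t ^+ 2], hence off the null set
     [[set 0]]. *)
  exists [set 0]; split => //; first exact: lebesgue_measure_set1.
  move=> t /= h; apply: contrapT => /eqP t0; apply: h.
  have t2 : t ^+ 2 != 0 by rewrite expf_neq0.
  apply: (mulfI t2); rewrite /vallee_poussin.
  have cE a : t ^+ 2 * c a t = 1 - cos (a * t).
    by rewrite /c -sqr_fejer exprMn; ring.
  rewrite [LHS](_ : _ = fejer_mass^-1 * (t ^+ 2 * c 2 t - t ^+ 2 * c 1 t) * cos (x * t)); last first.
    by rewrite /c; ring.
  rewrite [RHS](_ : _ = (2 * fejer_mass)^-1 * ((t ^+ 2 * c (2 + x) t + t ^+ 2 * c (2 - x) t) -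
    (t ^+ 2 * c (1 + x) t + t ^+ 2 * c (1 - x) t))); last by ring.
  rewrite !cE !(mulrDl _ _ t) !mulNr !cosD !cosN !sinN.
  by field.
have cD a b : \int[mu]_t (c a t + c b t) = (`|a| + `|b|) * fejer_mass.
  rewrite mulrDl -!RintegralT_fejer; exact: (RintegralD measurableT (c1 a) (c1 b)).
rewrite RintegralZl//; last exact: L1B.
rewrite (RintegralB measurableT (cs _ _) (cs _ _)) !cD.
rewrite !ger0_norm; [|lra..].
by field.
Qed.

Lemma vallee_poussin_sin x : \int[mu]_t (vallee_poussin t * sin (x * t)) = 0.
Proof.
have f1 : L1 (fun t => vallee_poussin t * sin (x * t)).
  apply: L1M; first exact: L1_vallee_poussin.
  exact: bounded_measurable_sin.
have := RintegralT_reflect 0 f1.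
under eq_Rintegral do rewrite sub0r vallee_poussinN mulrN sinN mulrN -mulN1r.
by rewrite RintegralZl// mulN1r => h; lra.
Qed.

(** [fejer] is a superposition of cosines of frequencies in [[-1, 1]], and convolution with [v]
    fixes each of them because the transform of [v] is 1 there. Fubini exchanges the superposition
    with the convolution. *)
Lemma conv_fejer v t : L1 v ->
  (forall x, `|x| <= 1 -> \int[mu]_t (v t * cos (x * t)) = 1) ->
  (forall x, \int[mu]_t (v t * sin (x * t)) = 0) ->
  conv v fejer t = fejer t.
Proof.
move=> v1 v_cos v_sin; have w1 := L1_fejer_weight.
have mw := L1_measurable w1; have mv := L1_measurable v1.
have wc1 s : L1 (fun x => fejer_weight x * cos (x * (t - s))) by exact: L1_fejer_weight_cos.
pose F (z : R * R) := v z.1 * (fejer_weight z.2 * cos (z.2 * (t - z.1))).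
have [|s||s|_ _ _ E] := @fubini_RintegralT _ F
   (fun s => (\int[mu]_x fejer_weight x) * `|v s|).
- apply: measurable_funM; first exact: measurableT_comp.
  apply: measurable_funM; first exact: measurableT_comp.
  apply: (measurableT_comp measurable_cos); apply: measurable_funM => //.
  exact: measurable_funB.
- exact: (L1Z (v s) (wc1 s)).
- exact/L1Z/L1_norm.
- rewrite /F /=; under eq_Rintegral do rewrite normrM.
  rewrite RintegralZl//; last exact: L1_norm.
  rewrite mulrC; apply: ler_wpM2r => //; apply: le_RintegralT => [||x].
  + exact: L1_norm.
  + exact: w1.
  + by rewrite normrM ger0_norm ?fejer_weight_ge0// ler_piMr ?fejer_weight_ge0// cos_max.
transitivity (\int[mu]_s \int[mu]_x F (s, x)).
  by apply: eq_Rintegral => s _; exact: (esym (RintegralZl (v s) measurableT (wc1 s))).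
rewrite E; apply: eq_Rintegral => x _; rewrite /F /=.
have [x1|x1] := ltP 1 `|x|.
  rewrite (fejer_weight_eq0 x1) mul0r; under eq_Rintegral do rewrite mul0r mulr0.
  by rewrite /Rintegral integral0.
have vc : L1 (fun s => v s * cos (x * s)).
  exact: (L1M v1 (bounded_measurable_cos x)).
have vs : L1 (fun s => v s * sin (x * s)).
  exact: (L1M v1 (bounded_measurable_sin x)).
transitivity (\int[mu]_s (fejer_weight x * (cos (x * t) * (v s * cos (x * s)) +
   sin (x * t) * (v s * sin (x * s))))).
  by apply: eq_Rintegral => s _; rewrite mulrBr cosB; ring.
have cvc : L1 (fun s => cos (x * t) * (v s * cos (x * s))) by exact: L1Z.
have cvs : L1 (fun s => sin (x * t) * (v s * sin (x * s))) by exact: L1Z.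
etransitivity; first exact: (RintegralZl _ measurableT (L1D cvc cvs)).
congr (_ * _); etransitivity; first exact: (RintegralD measurableT cvc cvs).
rewrite -[RHS]addr0; congr (_ + _).
  by rewrite -[RHS]mulr1 -(v_cos x x1); exact: (RintegralZl _ measurableT vc).
by rewrite -(mulr0 (sin (x * t))) -(v_sin x); exact: (RintegralZl _ measurableT vs).
Qed.

Lemma conv_vallee_poussin_fejer t : conv vallee_poussin fejer t = fejer t.
Proof.
exact: (conv_fejer t L1_vallee_poussin vallee_poussin_cos vallee_poussin_sin).
Qed.

Lemma bounded_measurable_vallee_poussin : bounded_measurable vallee_poussin.
Proof.
have [mf [B fB]] := bounded_measurable_fejer.
split; first by apply: L1_measurable; exact: L1_vallee_poussin.
exists (fejer_mass^-1 * (5 * B)) => t.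
have C0 := ltW fejer_mass_gt0.
rewrite normrM ger0_norm ?invr_ge0//.
apply: ler_wpM2l; first by rewrite invr_ge0.
rewrite expr1n mul1r (le_trans (ler_normB _ _))// normrM ger0_norm ?exprn_ge0//.
by have := fB (2 * t); have := fB (1 * t); lra.
Qed.

End FejerKernel.

(** * Behaviour at [+oo] and the contraction of eventual bounds *)

Section Contraction.
Variable R : realType.
Local Notation mu := (@lebesgue_measure R).
Implicit Types (k l f g p q E F G V : R -> R) (a b c x y t e M : R).

Definition vanishes F := F x @[x --> +oo] --> 0.

Lemma vanishesP F :
  vanishes F <-> forall e, 0 < e -> \forall x \near +oo, `|F x| <= e.
Proof.
split => [/cvgr0Pnorm_le h e e0|h]; first exact: h.
by apply/cvgr0Pnorm_le => e e0; exact: h.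
Qed.

Lemma near_pinftyP (P : R -> Prop) :
  (\forall x \near +oo, P x) <-> exists X : R, forall x, X < x -> P x.
Proof.
split => [[X [_ h]]|[X h]]; first by exists X.
by exists X; split => //; rewrite num_real.
Qed.

Lemma L1_tail k e : L1 k -> 0 < e ->
  exists N : R, \int[mu]_y (`|k y| * \1_`]N, +oo[ y) <= e.
Proof.
move=> k1 e0; have mk := L1_measurable k1.
have /cvgr0Pnorm_le /(_ e e0) :
    \int[mu]_y (`|k y| * \1_`]n%:R, +oo[ y) @[n --> \oo] --> 0.
  rewrite [X in _ --> X](_ : _ = \int[mu]_s (cst 0 s)); last first.
    by rewrite /Rintegral integral0.
  apply: (@dominated_RintegralT _ _ _ (fun s => `|k s|)) => [n||s||n s].
  - by apply: measurable_funM; [exact: measurableT_comp|exact: measurable_indic].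
  - exact: measurable_cst.
  - rewrite [X in _ --> X](_ : _ = `|k s| * 0); last by rewrite mulr0.
    apply: cvgM; first exact: cvg_cst.
    apply/cvgr0Pnorm_le => d d0; near=> n.
    rewrite indicE memNset ?normr0 ?ltW//= in_itv /= andbT => /ltW; apply/negP.
    rewrite -ltNge; near: n; exact: nbhs_infty_gtr.
  - exact: L1_norm.
  - rewrite normrM normr_id indicE ler_piMr//.
    by case: (_ \in _); rewrite ?normr1 ?normr0.
case=> n _ /(_ n (leqnn n)) /= h; exists n%:R.
exact: le_trans (ler_norm _) h.
Unshelve. all: by end_near. Qed.

(** For [y <= N] and [x > X + N] the argument [x - y] lies where [M] bounds [G]; for [y > N] only
    the global bound [B] is available, but there [k] has mass at most [e / (B + 1)]. *)
Lemma conv_tail_le k G M e : L1 k -> bounded_measurable G ->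
  (\forall x \near +oo, `|G x| <= M) -> 0 < e ->
  \forall x \near +oo, `|conv k G x| <= M * \int[mu]_y `|k y| + e.
Proof.
move=> k1 bG /near_pinftyP[X GM] e0; have [mG [B GB]] := bG.
have B0 : 0 <= B by exact: le_trans (GB 0).
have B1 : 0 < B + 1 by rewrite ltr_wpDl.
have [N kN] := L1_tail k1 (divr_gt0 e0 B1).
apply/near_pinftyP; exists (X + N) => x Xx.
have ki : L1 (fun y => `|k y| * \1_`]N, +oo[ y).
  apply: (L1_mulr (B := 1)); [exact: L1_norm|by []|move=> y].
  by rewrite indicE; case: (_ \in _); rewrite ?normr1 ?normr0.
apply: le_trans (normr_RintegralT (L1_conv x k1 bG)) _.
have h1 : L1 (fun y => M * `|k y|) by exact/L1Z/L1_norm.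
have h2 : L1 (fun y => (B + 1) * (`|k y| * \1_`]N, +oo[ y)) by exact: L1Z.
apply: (@le_trans _ _ (\int[mu]_y (M * `|k y| + (B + 1) * (`|k y| * \1_`]N, +oo[ y)))).
  apply: le_RintegralT => [||y].
  - exact/L1_norm/L1_conv.
  - exact: L1D.
  - have M0 : 0 <= M by apply: le_trans (GM (X + 1) _); rewrite ?ltrDl.
    rewrite normrM indicE; have [yN|yN] := boolP (y \in _).
      rewrite mulr1 mulrC -mulrDl ler_wpM2r// (le_trans (GB _))//; lra.
    rewrite !mulr0 addr0 mulrC ler_wpM2r// GM//.
    have : y <= N by move: yN; rewrite notin_setE /= in_itv /= andbT => /negP; rewrite -leNgt.
    by lra.
rewrite RintegralD// !RintegralZl//; last exact: L1_norm.
by rewrite lerD2l mulrC -ler_pdivlMr.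
Qed.

Lemma vanishes_conv k G : L1 k -> bounded_measurable G -> vanishes G ->
  vanishes (conv k G).
Proof.
move=> k1 bG /vanishesP G0; apply/vanishesP => e e0.
have k0 : 0 <= \int[mu]_y `|k y| by apply: Rintegral_ge0 => y _.
have d0 : 0 < e / 2 / (\int[mu]_y `|k y| + 1) by rewrite !divr_gt0// ltr_wpDl.
have e2 : 0 < e / 2 by rewrite divr_gt0.
apply: filterS (conv_tail_le k1 bG (G0 _ d0) e2) => x /le_trans; apply.
rewrite [leRHS](splitr e) lerD2r mulrAC ler_pdivrMr ?ltr_wpDl//.
by rewrite ler_pM2l// lerDl.
Qed.

(** Since [E = V * E], the difference is [u * E] with [u = p * V - (\int p) V]. This [u] is the
    average of [V (s - y) - V s] against [p y], so by Fubini its L1 norm is at most the integral of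
    [|p|] times the modulus of [V]. *)
Lemma conv_multiplier_le p V E M e : L1 p -> L1 V -> bounded_measurable V ->
  bounded_measurable E -> (forall x, conv V E x = E x) ->
  (\forall x \near +oo, `|E x| <= M) -> 0 < e ->
  \forall x \near +oo, `|conv p E x - (\int[mu]_y p y) * E x| <=
    M * \int[mu]_y (`|p y| * modulus V y) + e.
Proof.
move=> p1 V1 bV bE VE EM e0.
have mp := L1_measurable p1; have mV := L1_measurable V1.
have [pV1 pVE] := L1_conv2 V1 bV p1.
pose u s := conv p V s - (\int[mu]_y p y) * V s.
have u1 : L1 u by apply: L1B => //; exact: L1Z.
have uE s : u s = \int[mu]_y (p y * (V (s - y) - V s)).
  under eq_Rintegral do rewrite mulrBr.
  rewrite RintegralB//; [|exact: L1_conv|].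
    by rewrite /u RintegralZr.
  by under eq_fun do rewrite /= mulrC; exact: L1Z.
have h1 : L1 (fun y => `|p y| * modulus V y).
  apply: (L1_mulr (B := 2 * \int[mu]_s `|V s|)) => [||y].
  - exact: L1_norm.
  - exact: measurable_modulus.
  - by rewrite ger0_norm ?modulus_ge0// modulus_le.
have [|y||y|_ _ uh _] := @fubini_RintegralT _
    (fun z : R * R => p z.1 * (V (z.2 - z.1) - V z.2)) (fun y => `|p y| * modulus V y).
- apply: measurable_funM; first exact: measurableT_comp.
  apply: measurable_funB; last exact: measurableT_comp.
  by apply: measurableT_comp => //; exact: measurable_funB.
- exact: (L1Z (p y) (L1_shiftB y V1)).
- exact: h1.
- rewrite /=; under eq_Rintegral do rewrite normrM.
  by rewrite RintegralZl//; exact/L1_norm/L1_shiftB.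
apply: filterS (conv_tail_le u1 bE EM e0) => x.
have -> : conv u E x = conv p E x - (\int[mu]_y p y) * E x.
  rewrite -[in RHS]VE [LHS]/conv; under eq_Rintegral do rewrite /u mulrBl -mulrA.
  rewrite RintegralB//; [|exact: L1_conv|by apply: L1Z; exact: L1_conv].
  rewrite RintegralZl//; last exact: L1_conv.
  congr (_ - _); rewrite -[LHS]pVE//.
  by apply: eq_Rintegral => y _; rewrite VE.
move/le_trans; apply; rewrite lerD2r.
have M0 : 0 <= M.
  have /near_pinftyP[X hX] := EM.
  by apply: le_trans (hX (X + 1) _); rewrite ?ltrDl.
apply: ler_wpM2l => //; apply: le_trans uh.
by under eq_Rintegral do rewrite uE.
Qed.

Lemma ler_norm_approxD x y u v a b c : `|x - u| <= a -> `|y - v| <= b ->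
  `|x + y| <= c -> `|u + v| <= a + b + c.
Proof.
move=> xu yv xy.
rewrite (_ : u + v = (x + y) - ((x - u) + (y - v))); last ring.
rewrite (le_trans (ler_normB _ _))// addrC lerD// (le_trans (ler_normD _ _))//.
exact: lerD.
Qed.

(** Origin of [3 / 4]: one half from freezing the multiplier, one quarter from three error terms
    [d]. *)
Lemma contraction_bound D s t M d : 0 <= M -> s * t <= D / 2 -> 3 * s * d <= D * M / 4 ->
  s * (M * t + 3 * d) <= D * (3 / 4 * M).
Proof.
move=> M0 /(ler_wpM2l M0) h h'; rewrite mulrDr; lra.
Qed.

(** In complex terms [(p + i q) * (E1 + i E2)] vanishes at [+oo] and is close to
    [(a + i b) (E1 + i E2)]. The smallness hypothesis makes the discrepancy at most half of what
    dividing by [a + i b] costs. *)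
Lemma vanishes_contraction p q V E1 E2 :
  L1 p -> L1 q -> L1 V -> bounded_measurable V ->
  bounded_measurable E1 -> bounded_measurable E2 ->
  (forall x, conv V E1 x = E1 x) -> (forall x, conv V E2 x = E2 x) ->
  vanishes (fun x => conv p E1 x - conv q E2 x) ->
  vanishes (fun x => conv q E1 x + conv p E2 x) ->
  let a := \int[mu]_y p y in let b := \int[mu]_y q y in
  0 < a ^+ 2 + b ^+ 2 ->
  (`|a| + `|b|) * (\int[mu]_y (`|p y| * modulus V y) + \int[mu]_y (`|q y| * modulus V y))
    <= (a ^+ 2 + b ^+ 2) / 2 ->
  vanishes E1 /\ vanishes E2.
Proof.
move=> p1 q1 V1 bV bE1 bE2 VE1 VE2 /vanishesP v1 /vanishesP v2 a b ab0.
set eta := (_ + _ in X in _ * X <= _) => abeta.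
pose P M := \forall x \near +oo, `|E1 x| <= M /\ `|E2 x| <= M.
have step M : 0 < M -> P M -> P (3 / 4 * M).
  move=> M0 PM.
  have PM1 : \forall x \near +oo, `|E1 x| <= M by apply: filterS PM => x [].
  have PM2 : \forall x \near +oo, `|E2 x| <= M by apply: filterS PM => x [].
  pose s := `|a| + `|b|.
  have s0 : 0 <= s by rewrite addr_ge0.
  (* Makes [3 * s * d] at most a quarter of [(a ^+ 2 + b ^+ 2) * M]; the [+ 1] keeps the denominator
     visibly positive. *)
  pose d := (a ^+ 2 + b ^+ 2) * M / (12 * (s + 1)).
  have d0 : 0 < d by rewrite divr_gt0 ?mulr_gt0// ltr_wpDl.
  have sd : 3 * s * d <= (a ^+ 2 + b ^+ 2) * M / 4.
    rewrite /d mulrA ler_pdivrMr ?mulr_gt0// ?ltr_wpDl//.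
    have : 0 < (a ^+ 2 + b ^+ 2) * M by rewrite mulr_gt0.
    by move: ((a ^+ 2 + b ^+ 2) * M) s0 => D s0 D0; nra.
  near=> x.
  have h1 : `|conv p E1 x - a * E1 x| <= M * \int[mu]_y (`|p y| * modulus V y) + d.
    by near: x; exact: conv_multiplier_le.
  have h2 : `|conv q E2 x - b * E2 x| <= M * \int[mu]_y (`|q y| * modulus V y) + d.
    by near: x; exact: conv_multiplier_le.
  have h3 : `|conv q E1 x - b * E1 x| <= M * \int[mu]_y (`|q y| * modulus V y) + d.
    by near: x; exact: conv_multiplier_le.
  have h4 : `|conv p E2 x - a * E2 x| <= M * \int[mu]_y (`|p y| * modulus V y) + d.
    by near: x; exact: conv_multiplier_le.
  have h5 : `|conv p E1 x - conv q E2 x| <= d by near: x; exact: v1.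
  have h6 : `|conv q E1 x + conv p E2 x| <= d by near: x; exact: v2.
  have etaE : M * \int[mu]_y (`|p y| * modulus V y) + d +
      (M * \int[mu]_y (`|q y| * modulus V y) + d) + d = M * eta + 3 * d.
    by rewrite /eta; ring.
  have h2' : `|- conv q E2 x - - (b * E2 x)| <= M * \int[mu]_y (`|q y| * modulus V y) + d.
    by rewrite -opprD normrN.
  have A1 : `|a * E1 x - b * E2 x| <= M * eta + 3 * d.
    by rewrite -etaE; exact: ler_norm_approxD h1 h2' h5.
  have A2 : `|b * E1 x + a * E2 x| <= M * eta + 3 * d.
    by rewrite -etaE addrC; apply: ler_norm_approxD h4 h3 _; rewrite addrC.
  have bound : s * (M * eta + 3 * d) <= (a ^+ 2 + b ^+ 2) * (3 / 4 * M).
    exact: (contraction_bound (ltW M0) abeta sd).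
  (* The 2 by 2 system is inverted by its adjugate, that is, by multiplying with the conjugate of
     [a + i b]. *)
  split.
  - rewrite -(ler_pM2l ab0) -{1}(ger0_norm (ltW ab0)) -normrM.
    rewrite (_ : _ * E1 x = a * (a * E1 x - b * E2 x) + b * (b * E1 x + a * E2 x)); last ring.
    apply: le_trans bound; rewrite mulrDl.
    by apply: le_trans (ler_normD _ _) _; rewrite !normrM lerD// ler_wpM2l.
  - rewrite -(ler_pM2l ab0) -{1}(ger0_norm (ltW ab0)) -normrM.
    rewrite (_ : _ * E2 x = a * (b * E1 x + a * E2 x) - b * (a * E1 x - b * E2 x)); last ring.
    apply: le_trans bound; rewrite mulrDl.
    by apply: le_trans (ler_normB _ _) _; rewrite !normrM lerD// ler_wpM2l.
have [mE1 [B1 EB1]] := bE1; have [mE2 [B2 EB2]] := bE2.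
have B10 : 0 <= B1 by exact: le_trans (EB1 0).
have B20 : 0 <= B2 by exact: le_trans (EB2 0).
pose B := B1 + B2 + 1.
have B0 : 0 < B by rewrite ltr_wpDl ?addr_ge0.
(* The iteration starts from a global bound of both components. *)
have iter n : P ((3 / 4) ^+ n * B).
  elim: n => [|n IHn].
    apply: nearW => x; rewrite expr0 mul1r; split.
      by rewrite (le_trans (EB1 x))// /B -addrA lerDl addr_ge0.
    by rewrite (le_trans (EB2 x))// /B addrAC lerDr addr_ge0.
  by rewrite exprS -mulrA; apply: step => //; rewrite mulr_gt0 ?exprn_gt0.
suff all_e e : 0 < e -> P e.
  by split; apply/vanishesP => e /all_e; apply: filterS => x [].
move=> e0.
have /cvgr0Pnorm_le /(_ e e0) : (3 / 4) ^+ n * B @[n --> \oo] --> 0.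
  rewrite -[X in _ --> X](mul0r B); apply: cvgM; last exact: cvg_cst.
  by apply: cvg_expr; rewrite ger0_norm; lra.
case=> n _ /(_ n (leqnn n)) /= h.
apply: filterS (iter n) => x [h1 h2].
by split; apply: le_trans (le_trans (ler_norm _) h).
Unshelve. all: by end_near. Qed.

End Contraction.

(** * Dilation and modulation of kernels *)

Section Wiener.
Variable R : realType.
Local Notation mu := (@lebesgue_measure R).
Implicit Types (k l f g p q E F G V : R -> R) (a b c d x y t e M : R).

Lemma le_vanishes F G : (forall x, `|F x| <= `|G x|) -> vanishes G -> vanishes F.
Proof.
move=> FG /vanishesP G0; apply/vanishesP => e e0.
by apply: filterS (G0 e e0) => x; exact: le_trans.
Qed.

Lemma vanishesD F G : vanishes F -> vanishes G -> vanishes (fun x => F x + G x).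
Proof. by move=> F0 G0; rewrite /vanishes -(addr0 0); exact: cvgD. Qed.

Lemma vanishesN F : vanishes F -> vanishes (fun x => - F x).
Proof. by apply: le_vanishes => x; rewrite normrN. Qed.

Lemma vanishesB F G : vanishes F -> vanishes G -> vanishes (fun x => F x - G x).
Proof. by move=> F0 /vanishesN; exact: vanishesD. Qed.

Lemma vanishesZ c F : vanishes F -> vanishes (fun x => c * F x).
Proof. by move=> F0; rewrite /vanishes -(mulr0 c); apply: cvgM => //; exact: cvg_cst. Qed.

Lemma vanishes_cosM a F : vanishes F -> vanishes (fun x => cos (a * x) * F x).
Proof. by apply: le_vanishes => x; rewrite normrM ler_piMl// cos_max. Qed.

Lemma vanishes_sinM a F : vanishes F -> vanishes (fun x => sin (a * x) * F x).
Proof. by apply: le_vanishes => x; rewrite normrM ler_piMl// sin_max. Qed.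

Lemma convDl k l G x : L1 k -> L1 l -> bounded_measurable G ->
  conv (fun t => k t + l t) G x = conv k G x + conv l G x.
Proof.
move=> k1 l1 bG; rewrite /conv; under eq_Rintegral do rewrite mulrDl.
exact: (RintegralD measurableT (L1_conv x k1 bG) (L1_conv x l1 bG)).
Qed.

Lemma convZl c k G x : L1 k -> bounded_measurable G ->
  conv (fun t => c * k t) G x = c * conv k G x.
Proof.
move=> k1 bG; rewrite /conv; under eq_Rintegral do rewrite -mulrA.
exact: (RintegralZl c measurableT (L1_conv x k1 bG)).
Qed.

Lemma convBl k l G x : L1 k -> L1 l -> bounded_measurable G ->
  conv (fun t => k t - l t) G x = conv k G x - conv l G x.
Proof.
move=> k1 l1 bG; rewrite /conv; under eq_Rintegral do rewrite mulrBl.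
exact: (RintegralB measurableT (L1_conv x k1 bG) (L1_conv x l1 bG)).
Qed.

Lemma convDr k F G x : L1 k -> bounded_measurable F -> bounded_measurable G ->
  conv k (fun t => F t + G t) x = conv k F x + conv k G x.
Proof.
move=> k1 bF bG; rewrite /conv; under eq_Rintegral do rewrite mulrDr.
exact: (RintegralD measurableT (L1_conv x k1 bF) (L1_conv x k1 bG)).
Qed.

Lemma convBr k F G x : L1 k -> bounded_measurable F -> bounded_measurable G ->
  conv k (fun t => F t - G t) x = conv k F x - conv k G x.
Proof.
move=> k1 bF bG; rewrite /conv; under eq_Rintegral do rewrite mulrBr.
exact: (RintegralB measurableT (L1_conv x k1 bF) (L1_conv x k1 bG)).
Qed.

Lemma conv_ae_eq k l G x : {ae mu, forall t, k t = l t} -> L1 k -> L1 l ->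
  bounded_measurable G -> conv k G x = conv l G x.
Proof.
move=> kl k1 l1 bG; apply: RintegralT_ae_eq.
- by apply: (@filterS _ _ (ae_filter_ringOfSetsType mu)) kl => t ->.
- exact: (L1_measurable (L1_conv x k1 bG)).
- exact: (L1_measurable (L1_conv x l1 bG)).
Qed.

Lemma bounded_measurableN G : bounded_measurable G -> bounded_measurable (fun x => - G x).
Proof.
move=> [mG [B GB]]; split; first exact: measurable_funN.
by exists B => x; rewrite normrN.
Qed.

Lemma bounded_measurableB F G : bounded_measurable F -> bounded_measurable G ->
  bounded_measurable (fun x => F x - G x).
Proof. by move=> bF /bounded_measurableN; exact: bounded_measurableD. Qed.

(** Normalised to preserve the integral for [a > 0]. A small [a] stretches the kernel, hence narrows
    its Fourier transform: that of [dilation a fejer] lives on [[-a, a]]. *)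
Definition dilation a k t := a * k (a * t).

Lemma L1_dilation a k : 0 < a -> L1 k -> L1 (dilation a k).
Proof.
move=> a0 k1; apply: L1Z.
by apply: eq_L1 (L1_affine 0 (lt0r_neq0 a0) k1) => t; rewrite addr0.
Qed.

Lemma bounded_measurable_dilation a k :
  bounded_measurable k -> bounded_measurable (dilation a k).
Proof.
move=> [mk [B kB]]; split.
  by apply: measurable_funM => //; apply: measurableT_comp => //; exact: measurable_funM.
by exists (`|a| * B) => t; rewrite normrM ler_wpM2l.
Qed.

Lemma RintegralT_dilation a k : 0 < a -> L1 k ->
  \int[mu]_t dilation a k t = \int[mu]_t k t.
Proof.
move=> a0 k1; rewrite (RintegralT_affine 0 (lt0r_neq0 a0) k1) gtr0_norm//.
have ka1 := L1_affine 0 (lt0r_neq0 a0) k1.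
rewrite -RintegralZl//; apply: eq_Rintegral => t _.
by rewrite addr0.
Qed.

Lemma conv_dilation a k l x : 0 < a -> L1 k -> bounded_measurable l ->
  conv (dilation a k) (dilation a l) x = dilation a (conv k l) x.
Proof.
move=> a0 k1 bl; have kl1 := L1_conv (a * x) k1 bl.
rewrite [RHS]/dilation /conv -(RintegralT_dilation a0 kl1).
rewrite -RintegralZl//; last exact: L1_dilation.
by apply: eq_Rintegral => y _; rewrite /dilation mulrBr; ring.
Qed.

Lemma modulus_dilation a k t : 0 < a -> L1 k ->
  modulus (dilation a k) t = modulus k (a * t).
Proof.
move=> a0 k1; have km1 := L1_norm (L1_shiftB (a * t) k1).
rewrite [RHS]/modulus -(RintegralT_dilation a0 km1).
apply: eq_Rintegral => s _; rewrite /dilation -mulrBr normrM gtr0_norm//.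
by rewrite mulrBr.
Qed.

Lemma vanishes_conv_pair K p q g1 g2 : L1 K -> L1 p -> L1 q ->
  bounded_measurable g1 -> bounded_measurable g2 ->
  vanishes (fun x => conv p g1 x - conv q g2 x) ->
  vanishes (fun x => conv q g1 x + conv p g2 x) ->
  vanishes (fun x => conv p (conv K g1) x - conv q (conv K g2) x) /\
  vanishes (fun x => conv q (conv K g1) x + conv p (conv K g2) x).
Proof.
move=> K1 p1 q1 b1 b2 v1 v2.
have bp1 := bounded_measurable_conv p1 b1; have bp2 := bounded_measurable_conv p1 b2.
have bq1 := bounded_measurable_conv q1 b1; have bq2 := bounded_measurable_conv q1 b2.
split.
- have := vanishes_conv K1 (bounded_measurableB bp1 bq2) v1.
  by apply: le_vanishes => x; rewrite (convBr x K1 bp1 bq2) (conv_comm x K1 p1 b1) (conv_comm x K1 q1 b2).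
- have := vanishes_conv K1 (bounded_measurableD bq1 bp2) v2.
  by apply: le_vanishes => x; rewrite (convDr x K1 bq1 bp2) (conv_comm x K1 q1 b1) (conv_comm x K1 p1 b2).
Qed.

(** The case of frequency 0, since [a + i b] is the transform of [p + i q] there; other frequencies
    are brought to 0 by modulating [p], [q], [g1], [g2] beforehand. *)
Lemma vanishes_conv_fejer p q g1 g2 e : L1 p -> L1 q ->
  bounded_measurable g1 -> bounded_measurable g2 ->
  vanishes (fun x => conv p g1 x - conv q g2 x) ->
  vanishes (fun x => conv q g1 x + conv p g2 x) ->
  0 < e -> let V := dilation e (@vallee_poussin R) in
  let a := \int[mu]_y p y in let b := \int[mu]_y q y in
  0 < a ^+ 2 + b ^+ 2 ->
  (`|a| + `|b|) * (\int[mu]_y (`|p y| * modulus V y) + \int[mu]_y (`|q y| * modulus V y))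
    <= (a ^+ 2 + b ^+ 2) / 2 ->
  vanishes (conv (dilation e (@fejer R)) g1) /\ vanishes (conv (dilation e (@fejer R)) g2).
Proof.
move=> p1 q1 b1 b2 v1 v2 e0 V a b ab0 small.
have V1 : L1 V by apply: L1_dilation => //; exact: L1_vallee_poussin.
have bV : bounded_measurable V.
  by apply: bounded_measurable_dilation; exact: bounded_measurable_vallee_poussin.
pose K := dilation e (@fejer R).
have K1 : L1 K by apply: L1_dilation => //; exact: L1_fejer.
have bK : bounded_measurable K.
  by apply: bounded_measurable_dilation; exact: bounded_measurable_fejer.
have VK : conv V K = K.
  apply/funext => x; rewrite /V /K conv_dilation//.
  - by rewrite /dilation conv_vallee_poussin_fejer.
  - exact: L1_vallee_poussin.
  - exact: bounded_measurable_fejer.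
have VE g x : bounded_measurable g -> conv V (conv K g) x = conv K g x.
  by move=> bg; rewrite (L1_conv2 K1 bK V1).2// VK.
have [w1 w2] := vanishes_conv_pair K1 p1 q1 b1 b2 v1 v2.
apply: (vanishes_contraction p1 q1 V1 bV _ _ _ _ w1 w2 ab0 small).
- exact: bounded_measurable_conv.
- exact: bounded_measurable_conv.
- by move=> x; exact: VE.
- by move=> x; exact: VE.
Qed.

(* With [z := u + i v], these are the real and imaginary parts of [exp (-i c x) z x]. *)
Definition modulate_re c f g x := cos (c * x) * f x + sin (c * x) * g x.
Definition modulate_im c f g x := cos (c * x) * g x - sin (c * x) * f x.

Lemma L1_modulate_re c p q : L1 p -> L1 q -> L1 (modulate_re c p q).
Proof.
move=> p1 q1; apply: (eq_L1 (k := fun x => p x * cos (c * x) + q x * sin (c * x))).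
  by move=> x; rewrite /modulate_re mulrC [q x * _]mulrC.
apply: L1D; apply: L1M => //; first exact: bounded_measurable_cos.
exact: bounded_measurable_sin.
Qed.

Lemma L1_modulate_im c p q : L1 p -> L1 q -> L1 (modulate_im c p q).
Proof.
move=> p1 q1; apply: (eq_L1 (k := fun x => q x * cos (c * x) - p x * sin (c * x))).
  by move=> x; rewrite /modulate_im mulrC [p x * _]mulrC.
apply: L1B; apply: L1M => //; first exact: bounded_measurable_cos.
exact: bounded_measurable_sin.
Qed.

Lemma bounded_measurable_modulate_re c f g : bounded_measurable f ->
  bounded_measurable g -> bounded_measurable (modulate_re c f g).
Proof.
move=> bf bg; apply: bounded_measurableD; apply: bounded_measurableM => //.
  exact: bounded_measurable_cos.
exact: bounded_measurable_sin.
Qed.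

Lemma bounded_measurable_modulate_im c f g : bounded_measurable f ->
  bounded_measurable g -> bounded_measurable (modulate_im c f g).
Proof.
move=> bf bg; apply: bounded_measurableB; apply: bounded_measurableM => //.
  exact: bounded_measurable_cos.
exact: bounded_measurable_sin.
Qed.

Lemma modulate_re_le c f g x : `|modulate_re c f g x| <= `|f x| + `|g x|.
Proof.
rewrite /modulate_re (le_trans (ler_normD _ _))// !normrM lerD// ler_piMl//.
  exact: cos_max.
exact: sin_max.
Qed.

Lemma modulate_im_le c f g x : `|modulate_im c f g x| <= `|f x| + `|g x|.
Proof.
rewrite /modulate_im (le_trans (ler_normB _ _))// !normrM addrC lerD// ler_piMl//.
  exact: sin_max.
exact: cos_max.
Qed.

(** A character is multiplicative, so modulating both factors of a convolution modulates the result;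
    the addition formulas for [x = y + (x - y)] express this. Modulation mixes the two components by
    bounded factors, so vanishing persists. *)
Lemma vanishes_modulate p q g1 g2 c : L1 p -> L1 q ->
  bounded_measurable g1 -> bounded_measurable g2 ->
  vanishes (fun x => conv p g1 x - conv q g2 x) ->
  vanishes (fun x => conv q g1 x + conv p g2 x) ->
  let p' := modulate_re c p q in let q' := modulate_im c p q in
  let h1 := modulate_re c g1 g2 in let h2 := modulate_im c g1 g2 in
  vanishes (fun x => conv p' h1 x - conv q' h2 x) /\
  vanishes (fun x => conv q' h1 x + conv p' h2 x).
Proof.
move=> p1 q1 b1 b2 v1 v2 p' q' h1 h2.
have p'1 : L1 p' by exact: L1_modulate_re.
have q'1 : L1 q' by exact: L1_modulate_im.
have bh1 : bounded_measurable h1 by exact: bounded_measurable_modulate_re.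
have bh2 : bounded_measurable h2 by exact: bounded_measurable_modulate_im.
have lp1 x := L1_conv x p1 b1; have lp2 x := L1_conv x p1 b2.
have lq1 x := L1_conv x q1 b1; have lq2 x := L1_conv x q1 b2.
have cE x y : cos (c * x) = cos (c * y) * cos (c * (x - y)) - sin (c * y) * sin (c * (x - y)).
  by rewrite -cosD -mulrDr addrC subrK.
have sE x y : sin (c * x) = sin (c * y) * cos (c * (x - y)) + cos (c * y) * sin (c * (x - y)).
  by rewrite -sinD -mulrDr addrC subrK.
have reE x : modulate_re c (fun x => conv p g1 x - conv q g2 x)
    (fun x => conv q g1 x + conv p g2 x) x = conv p' h1 x - conv q' h2 x.
  rewrite /modulate_re -(RintegralB measurableT (lp1 x) (lq2 x)).
  rewrite -(RintegralD measurableT (lq1 x) (lp2 x)).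
  rewrite -(RintegralB measurableT (L1_conv x p'1 bh1) (L1_conv x q'1 bh2)).
  rewrite -(RintegralZl _ measurableT (L1B (lp1 x) (lq2 x))).
  rewrite -(RintegralZl _ measurableT (L1D (lq1 x) (lp2 x))).
  rewrite -(RintegralD measurableT (L1Z _ (L1B (lp1 x) (lq2 x))) (L1Z _ (L1D (lq1 x) (lp2 x)))).
  apply: eq_Rintegral => y _.
  by rewrite /p' /q' /h1 /h2 /modulate_re /modulate_im (cE x y) (sE x y); ring.
have imE x : modulate_im c (fun x => conv p g1 x - conv q g2 x)
    (fun x => conv q g1 x + conv p g2 x) x = conv q' h1 x + conv p' h2 x.
  rewrite /modulate_im -(RintegralB measurableT (lp1 x) (lq2 x)).
  rewrite -(RintegralD measurableT (lq1 x) (lp2 x)).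
  rewrite -(RintegralD measurableT (L1_conv x q'1 bh1) (L1_conv x p'1 bh2)).
  rewrite -(RintegralZl _ measurableT (L1B (lp1 x) (lq2 x))).
  rewrite -(RintegralZl _ measurableT (L1D (lq1 x) (lp2 x))).
  rewrite -(RintegralB measurableT (L1Z _ (L1D (lq1 x) (lp2 x))) (L1Z _ (L1B (lp1 x) (lq2 x)))).
  apply: eq_Rintegral => y _.
  by rewrite /p' /q' /h1 /h2 /modulate_re /modulate_im (cE x y) (sE x y); ring.
split.
- rewrite -(funext reE); apply: vanishesD; first exact: vanishes_cosM.
  exact: vanishes_sinM.
- rewrite -(funext imE); apply: vanishesB; first exact: vanishes_cosM.
  exact: vanishes_sinM.
Qed.

(** Multiplying [K * (exp (- i d x) g)] by [exp (i d x)] moves the modulation onto [K]. Averaging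
    [d = c] and [d = - c] leaves the real kernel [K cos], which separates [g1] from [g2]. *)
Lemma vanishes_conv_cos K g1 g2 c : L1 K ->
  bounded_measurable g1 -> bounded_measurable g2 ->
  (forall d, `|d| = `|c| -> vanishes (conv K (modulate_re d g1 g2)) /\
    vanishes (conv K (modulate_im d g1 g2))) ->
  vanishes (conv (fun t => K t * cos (c * t)) g1) /\
  vanishes (conv (fun t => K t * cos (c * t)) g2).
Proof.
move=> K1 b1 b2 v.
have bre d := bounded_measurable_modulate_re d b1 b2.
have bim d := bounded_measurable_modulate_im d b1 b2.
have Kc1 d : L1 (fun t => K t * cos (d * t)) by exact: (L1M K1 (bounded_measurable_cos d)).
have Ks1 d : L1 (fun t => K t * sin (d * t)) by exact: (L1M K1 (bounded_measurable_sin d)).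
have cE d x y : cos (d * y) = cos (d * x) * cos (d * (x - y)) + sin (d * x) * sin (d * (x - y)).
  by rewrite -cosB -mulrBr subKr.
have sE d x y : sin (d * y) = sin (d * x) * cos (d * (x - y)) - cos (d * x) * sin (d * (x - y)).
  by rewrite -sinB -mulrBr subKr.
have reE d x : conv (fun t => K t * cos (d * t)) g1 x - conv (fun t => K t * sin (d * t)) g2 x =
    cos (d * x) * conv K (modulate_re d g1 g2) x - sin (d * x) * conv K (modulate_im d g1 g2) x.
  rewrite -(RintegralB measurableT (L1_conv x (Kc1 d) b1) (L1_conv x (Ks1 d) b2)).
  have l1 := L1_conv x K1 (bre d); have l2 := L1_conv x K1 (bim d).
  rewrite -(RintegralZl _ measurableT l1) -(RintegralZl _ measurableT l2).
  rewrite -(RintegralB measurableT (L1Z _ l1) (L1Z _ l2)).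
  apply: eq_Rintegral => y _.
  by rewrite /modulate_re /modulate_im (cE d x y) (sE d x y); ring.
have imE d x : conv (fun t => K t * cos (d * t)) g2 x + conv (fun t => K t * sin (d * t)) g1 x =
    sin (d * x) * conv K (modulate_re d g1 g2) x + cos (d * x) * conv K (modulate_im d g1 g2) x.
  rewrite -(RintegralD measurableT (L1_conv x (Kc1 d) b2) (L1_conv x (Ks1 d) b1)).
  have l1 := L1_conv x K1 (bre d); have l2 := L1_conv x K1 (bim d).
  rewrite -(RintegralZl _ measurableT l1) -(RintegralZl _ measurableT l2).
  rewrite -(RintegralD measurableT (L1Z _ l1) (L1Z _ l2)).
  apply: eq_Rintegral => y _.
  by rewrite /modulate_re /modulate_im (cE d x y) (sE d x y); ring.
have vre d : `|d| = `|c| -> vanishes (fun x =>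
    conv (fun t => K t * cos (d * t)) g1 x - conv (fun t => K t * sin (d * t)) g2 x).
  move=> /v[w1 w2]; rewrite (funext (reE d)); apply: vanishesB.
    exact: vanishes_cosM.
  exact: vanishes_sinM.
have vim d : `|d| = `|c| -> vanishes (fun x =>
    conv (fun t => K t * cos (d * t)) g2 x + conv (fun t => K t * sin (d * t)) g1 x).
  move=> /v[w1 w2]; rewrite (funext (imE d)); apply: vanishesD.
    exact: vanishes_sinM.
  exact: vanishes_cosM.
have cosNE g x : conv (fun t => K t * cos (- c * t)) g x = conv (fun t => K t * cos (c * t)) g x.
  by apply: eq_Rintegral => y _; rewrite mulNr cosN.
have sinNE g x : bounded_measurable g ->
    conv (fun t => K t * sin (- c * t)) g x = - conv (fun t => K t * sin (c * t)) g x.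
  move=> bg; rewrite -[RHS]mulN1r -(convZl (-1) x (Ks1 c) bg).
  by apply: eq_Rintegral => y _; rewrite mulNr sinN; ring.
split.
- have := vanishesZ 2^-1 (vanishesD (vre c erefl) (vre (- c) (normrN c))).
  apply: le_vanishes => x; rewrite cosNE sinNE//.
  rewrite opprK addrACA addNr addr0.
  by rewrite (_ : 2^-1 * _ = conv (fun t => K t * cos (c * t)) g1 x)//; field.
- have := vanishesZ 2^-1 (vanishesD (vim c erefl) (vim (- c) (normrN c))).
  apply: le_vanishes => x; rewrite cosNE sinNE//.
  rewrite addrACA subrr addr0.
  by rewrite (_ : 2^-1 * _ = conv (fun t => K t * cos (c * t)) g2 x)//; field.
Qed.

End Wiener.

(** * Wiener's Tauberian theorem *)

Section WienerTheorem.
Variable R : realType.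
Local Notation mu := (@lebesgue_measure R).
Implicit Types (k l f g p q E F G V : R -> R) (a b c x y t e M : R).

Lemma bounded_measurable_modulus k : L1 k -> bounded_measurable (modulus k).
Proof.
move=> k1; split; first exact: (measurable_modulus (L1_measurable k1)).
by exists (2 * \int[mu]_s `|k s|) => t; rewrite ger0_norm ?modulus_ge0// modulus_le.
Qed.

(** Continuity of the Fourier transform, by dominated convergence with majorant [|p| + |q|]. It
    provides a positive minimum of the squared modulus of the transform on a compact interval. *)
Lemma continuous_Rintegral_modulate p q :
  L1 p -> L1 q -> continuous (fun c => \int[mu]_y modulate_re c p q y) /\
  continuous (fun c => \int[mu]_y modulate_im c p q y).
Proof.
move=> p1 q1; have pq1 := L1D (L1_norm p1) (L1_norm q1).
have cos_cont y : continuous (fun c : R => cos (c * y)).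
  move=> c; apply: (@continuous_comp _ _ _ (fun c => c * y) cos).
    by apply: cvgM; [exact: cvg_id|exact: cvg_cst].
  exact: continuous_cos.
have sin_cont y : continuous (fun c : R => sin (c * y)).
  move=> c; apply: (@continuous_comp _ _ _ (fun c => c * y) sin).
    by apply: cvgM; [exact: cvg_id|exact: cvg_cst].
  exact: continuous_sin.
split=> c; apply/(@cvg_nbhsP _ R^o) => w wc.
- apply: (dominated_RintegralT _ _ _ pq1) => [n||y|n y].
  + exact: (L1_measurable (L1_modulate_re _ p1 q1)).
  + exact: (L1_measurable (L1_modulate_re _ p1 q1)).
  + apply: cvgD; apply: cvgM; try exact: cvg_cst.
      exact: (continuous_cvg _ (cos_cont y c) wc).
    exact: (continuous_cvg _ (sin_cont y c) wc).
  + exact: modulate_re_le.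
- apply: (dominated_RintegralT _ _ _ pq1) => [n||y|n y].
  + exact: (L1_measurable (L1_modulate_im _ p1 q1)).
  + exact: (L1_measurable (L1_modulate_im _ p1 q1)).
  + apply: cvgB; apply: cvgM; try exact: cvg_cst.
      exact: (continuous_cvg _ (cos_cont y c) wc).
    exact: (continuous_cvg _ (sin_cont y c) wc).
  + exact: modulate_im_le.
Qed.

(* [1 - cos ((m + 2) s)] is a combination of [1 - cos ((m + 1) s)], [1 - cos (m s)] and
   [(1 - cos s) cos ((m + 1) s)]: the triangle of width [m] splits into narrow triangles. *)
Lemma vanishes_conv_fejer_mul g e N : bounded_measurable g -> 0 < e ->
  (forall m : nat, (m <= N)%N ->
    vanishes (conv (fun t => dilation e (@fejer R) t * cos ((m%:R * e) * t)) g)) ->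
  vanishes (conv (dilation (N.+1%:R * e) (@fejer R)) g).
Proof.
move=> bg e0 v; have f1 := @L1_fejer R.
pose K (m : nat) := dilation (m%:R * e) (@fejer R).
have KE m t : t ^+ 2 * (m%:R * K m t) = m%:R / (m%:R * e) * (1 - cos (m%:R * e * t)).
  rewrite /K /dilation -sqr_fejer.
  have [->|m0] := eqVneq m 0%N; first by rewrite !mul0r mulr0.
  have m0' : m%:R != 0 :> R by rewrite pnatr_eq0.
  by field; rewrite m0' lt0r_neq0.
(* With this normalisation [t ^+ 2 * c1 m t] has the prefactor [e^-1] for every [m], and [c1 0] is
   0, so the recurrence has constant coefficients and starts at 0. *)
pose c1 m t := m%:R * K m t.
have c_1 m : L1 (c1 m).
  have [->|m0] := posnP m.
    apply: (eq_L1 (k := fun t => 0 * fejer t)); last exact: L1Z.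
    by move=> t; rewrite /c1 !mul0r.
  by apply: L1Z; apply: L1_dilation => //; rewrite mulr_gt0 ?ltr0n.
have d1 : L1 (dilation e (@fejer R)) by exact: L1_dilation.
have dc1 m : L1 (fun t => dilation e (@fejer R) t * cos ((m%:R * e) * t)).
  exact: (L1M d1 (bounded_measurable_cos _)).
have c1E m t : t ^+ 2 * c1 m t = e^-1 * (1 - cos (m%:R * e * t)).
  rewrite /c1 KE; have [->|m0] := eqVneq m 0%N.
    by rewrite !mul0r cos0 subrr mulr0.
  by congr (_ * _); field; rewrite pnatr_eq0 m0 lt0r_neq0.
have dE t : t ^+ 2 * dilation e (@fejer R) t = e^-1 * (1 - cos (e * t)).
  by have := c1E 1%N t; rewrite /c1 /K mul1r mul1r.
have rec m x : conv (c1 m.+2) g x = 2 * conv (c1 m.+1) g x - conv (c1 m) g x +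
    2 * conv (fun t => dilation e (@fejer R) t * cos ((m.+1%:R * e) * t)) g x.
  rewrite -!convZl// -convBl//; last exact: L1Z.
  rewrite -convDl//; [|by apply: L1B => //; exact: L1Z|exact: L1Z].
  apply: conv_ae_eq => //; last first.
    by apply: L1D; [apply: L1B => //; exact: L1Z|exact: L1Z].
  exists [set 0]; split => //; first exact: lebesgue_measure_set1.
  move=> t /= h; apply: contrapT => /eqP t0; apply: h.
  have t2 : t ^+ 2 != 0 by rewrite expf_neq0.
  apply: (mulfI t2).
  rewrite [RHS](_ : _ = 2 * (t ^+ 2 * c1 m.+1 t) - t ^+ 2 * c1 m t +
    2 * (t ^+ 2 * dilation e (@fejer R) t) * cos (m.+1%:R * e * t)); last ring.
  rewrite !c1E dE.
  have -> : m.+2%:R * e * t = m.+1%:R * e * t + e * t by rewrite -[m.+2%:R]natr1; ring.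
  have -> : m%:R * e * t = m.+1%:R * e * t - e * t by rewrite -[m.+1%:R]natr1; ring.
  by rewrite cosD cosB; ring.
(* The recurrence has order two, so the induction carries two consecutive indices; [c1 1] is the
   narrow kernel itself, covered by [v] at 0. *)
have vc m : (m <= N)%N -> vanishes (conv (c1 m) g) /\ vanishes (conv (c1 m.+1) g).
  elim: m => [_|m IHm mN].
    split.
      apply: (@le_vanishes _ _ (cst 0)); last exact: cvg_cst.
      move=> x; rewrite (_ : c1 0%N = fun t => 0 * fejer t) ?convZl ?mul0r//.
      by apply/funext => t; rewrite /c1 !mul0r.
    have := v 0%N isT; apply: le_vanishes => x.
    rewrite (_ : conv _ g x = conv (c1 1%N) g x)//; apply: eq_Rintegral => t _.
    by rewrite /c1 /K !mul1r !mul0r cos0 mulr1.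
  have [v0 v1] := IHm (ltnW mN); split; first exact: v1.
  rewrite (funext (rec m)); apply: vanishesD; last by apply: vanishesZ; exact: v.
  by apply: vanishesB => //; exact: vanishesZ.
have [_ vN] := vc N (leqnn N).
have := vanishesZ N.+1%:R^-1 vN; apply: le_vanishes => x.
rewrite (_ : conv (c1 N.+1) g x = N.+1%:R * conv (K N.+1) g x).
  by rewrite mulKf ?pnatr_eq0.
by apply: convZl => //; apply: L1_dilation => //; rewrite mulr_gt0 ?ltr0n.
Qed.

(** The order of choices matters: the target width [l] fixes the interval of frequencies and the
    minimum [D] of the squared transform on it, and only then is [N] chosen. One narrow width
    [l / (N + 1)] then works for all these frequencies. *)
Lemma vanishes_conv_fejer_all p q g1 g2 (l : R) : L1 p -> L1 q ->
  bounded_measurable g1 -> bounded_measurable g2 ->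
  vanishes (fun x => conv p g1 x - conv q g2 x) ->
  vanishes (fun x => conv q g1 x + conv p g2 x) ->
  (forall c, 0 < (\int[mu]_y modulate_re c p q y) ^+ 2 + (\int[mu]_y modulate_im c p q y) ^+ 2) ->
  0 < l ->
  vanishes (conv (dilation l (@fejer R)) g1) /\ vanishes (conv (dilation l (@fejer R)) g2).
Proof.
move=> p1 q1 b1 b2 v1 v2 ab0 l0.
pose a c := \int[mu]_y modulate_re c p q y; pose b c := \int[mu]_y modulate_im c p q y.
have [ca cb] := continuous_Rintegral_modulate p1 q1.
have pq1 : L1 (fun y => `|p y| + `|q y|) by exact: L1D (L1_norm p1) (L1_norm q1).
pose P := \int[mu]_y (`|p y| + `|q y|).
have P0 : 0 <= P by apply: Rintegral_ge0 => y _; rewrite addr_ge0.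
have re1 c := L1_modulate_re c p1 q1; have im1 c := L1_modulate_im c p1 q1.
have aP c : `|a c| <= P.
  apply: le_trans (normr_RintegralT (re1 c)) _.
  by apply: le_RintegralT (L1_norm (re1 c)) pq1 _ => y; exact: modulate_re_le.
have bP c : `|b c| <= P.
  apply: le_trans (normr_RintegralT (im1 c)) _.
  by apply: le_RintegralT (L1_norm (im1 c)) pq1 _ => y; exact: modulate_im_le.
have [||c0 _ c0min] := @EVT_min R (fun c => a c ^+ 2 + b c ^+ 2) (- l) l.
- by rewrite (@le_trans _ _ 0)// ?oppr_le0 ltW.
- apply: continuous_subspaceT => c; apply: cvgD; apply: cvgM; [exact: ca|exact: ca|exact: cb|exact: cb].
pose D := a c0 ^+ 2 + b c0 ^+ 2; have D0 : 0 < D by exact: ab0.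
pose V e := dilation e (@vallee_poussin R).
have V1 e : 0 < e -> L1 (V e) by move=> e0; apply: L1_dilation => //; exact: L1_vallee_poussin.
(* Chosen so that [(P + P) * (d + d) <= D / 2], where [P] bounds both components of the
   transform. *)
pose d := D / 2 / (4 * P + 1).
have d0 : 0 < d by rewrite !divr_gt0// ltr_wpDl// mulr_ge0.
have /cvgr0Pnorm_le /(_ d d0)[N _ /(_ N (leqnn N)) /= hN] := modulus_average_cvg0 pq1 (V1 l l0).
pose e := N.+1%:R^-1 * l.
have e0 : 0 < e by rewrite mulr_gt0 ?invr_gt0.
have Nel : N.+1%:R * e = l by rewrite /e mulVKf ?pnatr_eq0.
have modE y : modulus (V l) (y / N.+1%:R) = modulus (V e) y.
  have vp1 := @L1_vallee_poussin R.
  rewrite (modulus_dilation _ l0 vp1) (modulus_dilation _ e0 vp1).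
  by have -> : l * (y / N.+1%:R) = e * y by rewrite /e; ring.
have hint : \int[mu]_y ((`|p y| + `|q y|) * modulus (V e) y) <= d.
  apply: le_trans (le_trans (ler_norm _) hN).
  rewrite le_eqVlt; apply/orP; left; apply/eqP; apply: eq_Rintegral => y _.
  by rewrite modE (ger0_norm (addr_ge0 _ _)).
have mV := bounded_measurable_modulus (V1 e e0).
(* Both modulated kernels are dominated by [|p| + |q|] whatever the frequency; this gives uniformity
   in [c]. *)
have smallmod k : L1 k -> (forall y, `|k y| <= `|p y| + `|q y|) ->
    \int[mu]_y (`|k y| * modulus (V e) y) <= d.
  move=> k1 kpq; apply: le_trans hint; apply: le_RintegralT => [||y].
  - exact: (L1M (L1_norm k1) mV).
  - exact: (L1M pq1 mV).
  - by rewrite ler_wpM2r ?modulus_ge0.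
have vmod c : `|c| <= l -> vanishes (conv (dilation e (@fejer R)) (modulate_re c g1 g2)) /\
    vanishes (conv (dilation e (@fejer R)) (modulate_im c g1 g2)).
  move=> cl; have [w1 w2] := vanishes_modulate c p1 q1 b1 b2 v1 v2.
  apply: (vanishes_conv_fejer (re1 c) (im1 c) _ _ w1 w2 e0).
  - exact: bounded_measurable_modulate_re.
  - exact: bounded_measurable_modulate_im.
  - exact: ab0.
  - have Dc : D <= a c ^+ 2 + b c ^+ 2 by apply: c0min; rewrite in_itv /= -ler_norml.
    apply: (@le_trans _ _ (D / 2)); last by rewrite ler_pM2r.
    apply: (@le_trans _ _ ((P + P) * (d + d))).
      apply: ler_pM.
      + by rewrite addr_ge0.
      + by rewrite addr_ge0//; apply: Rintegral_ge0 => y _; rewrite mulr_ge0 ?modulus_ge0.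
      + by rewrite lerD ?aP ?bP.
      + by rewrite lerD// smallmod// => y; [exact: modulate_re_le|exact: modulate_im_le].
    have -> : (P + P) * (d + d) = 4 * P * d by ring.
    have <- : (4 * P + 1) * d = D / 2.
      by rewrite /d mulrC divfK// lt0r_neq0// ltr_wpDl// mulr_ge0.
    by rewrite ler_pM2r// lerDl.
have vcos m : (m <= N)%N ->
    vanishes (conv (fun t => dilation e (@fejer R) t * cos ((m%:R * e) * t)) g1) /\
    vanishes (conv (fun t => dilation e (@fejer R) t * cos ((m%:R * e) * t)) g2).
  move=> mN; apply: vanishes_conv_cos => //.
    by apply: L1_dilation => //; exact: L1_fejer.
  move=> c cm; apply: vmod; rewrite cm (ger0_norm (mulr_ge0 (ler0n _ m) (ltW e0))).
  by rewrite -Nel ler_pM2r// ler_nat leqW.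
rewrite -Nel; split; apply: vanishes_conv_fejer_mul => // m /vcos[] //.
Qed.

(** As [g] is only bounded, the variable [x] is moved onto [k], whose translation modulus then
    controls the increment uniformly in [x]. *)
Lemma normr_convB_le k g (B : R) x y : L1 k -> bounded_measurable g -> (forall t, `|g t| <= B) ->
  `|conv k g x - conv k g (x - y)| <= B * modulus k y.
Proof.
move=> k1 bg gB; rewrite !convE//.
have s1 z : L1 (fun t => k (z - t)) by exact: L1_reflect.
have kg1 z : L1 (fun t => k (z - t) * g t) by exact: (L1M (s1 z) bg).
rewrite -(RintegralB measurableT (kg1 x) (kg1 (x - y))).
under eq_Rintegral do rewrite -mulrBl.
apply: le_trans (le_RintegralM (L1B (s1 x) (s1 (x - y))) bg gB) _.
have B0 : 0 <= B by exact: le_trans (gB 0).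
apply: ler_wpM2l => //.
rewrite [leRHS](_ : _ = \int[mu]_t `|k (x - t - y) - k (x - t)|); last first.
  exact: (esym (RintegralT_reflect x (L1_norm (L1_shiftB y k1)))).
rewrite le_eqVlt; apply/orP; left; apply/eqP; apply: eq_Rintegral => t _.
by rewrite distrC; congr (`|k _ - _|); ring.
Qed.

(** A concentrated Fejer kernel [K] approximates its mass times the identity on [k * g], uniformly
    in [x], because [k * g] is uniformly continuous. The approximation [K * (k * g)] equals
    [k * (K * g)], which vanishes at [+oo]. *)
Lemma vanishes_conv_of_fejer g k : bounded_measurable g -> L1 k ->
  (forall l : R, 0 < l -> vanishes (conv (dilation l (@fejer R)) g)) ->
  vanishes (conv k g).
Proof.
move=> bg k1 v; have f1 := @L1_fejer R; have C0 := @fejer_mass_gt0 R.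
have bH := bounded_measurable_conv k1 bg; have [mg [B gB]] := bg.
have B0 : 0 <= B by exact: le_trans (gB 0).
have B1 : 0 < B + 1 by rewrite ltr_wpDl.
apply/vanishesP => e e0.
(* Half of the tolerance, scaled by the mass of [fejer], divided by a strictly positive bound of
   [g]. *)
pose d := e * fejer_mass R / 2 / (B + 1).
have d0 : 0 < d by rewrite !divr_gt0// mulr_gt0.
have /cvgr0Pnorm_le /(_ d d0)[N _ /(_ N (leqnn N)) /= hN] := modulus_average_cvg0 f1 k1.
pose K := dilation N.+1%:R (@fejer R).
have N0 : 0 < N.+1%:R :> R by [].
have K1 : L1 K by exact: L1_dilation.
have mK := bounded_measurable_modulus k1.
have Kmod : \int[mu]_y (`|K y| * modulus k y) <= d.
  apply: le_trans (le_trans (ler_norm _) hN).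
  have h1 : L1 (fun y => `|fejer y| * modulus k (y / N.+1%:R)).
    apply: (L1M (L1_norm f1)); split.
      apply: (measurableT_comp (measurable_modulus (L1_measurable k1))).
      exact: measurable_funM.
    by have [_ [M kM]] := mK; exists M => y; exact: kM.
  rewrite -(RintegralT_dilation N0 h1) le_eqVlt; apply/orP; left; apply/eqP.
  apply: eq_Rintegral => y _; rewrite /K /dilation normrM gtr0_norm// mulrA.
  by congr (_ * modulus k _); rewrite mulrAC divff ?mul1r ?lt0r_neq0.
have approx x : `|fejer_mass R * conv k g x - conv K (conv k g) x| <= e * fejer_mass R / 2.
  rewrite /fejer_mass -(RintegralT_dilation N0 f1) -RintegralZr//.
  have Kc : L1 (fun y => K y * conv k g x).
    by apply: (L1M K1); exact: bounded_measurable_cst.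
  have KH := L1_conv x K1 bH.
  rewrite -(RintegralB measurableT Kc KH).
  apply: le_trans (normr_RintegralT (L1B Kc KH)) _.
  apply: (@le_trans _ _ (\int[mu]_y (B * (`|K y| * modulus k y)))).
    apply: le_RintegralT => [||y].
    - exact: (L1_norm (L1B Kc KH)).
    - exact: (L1Z _ (L1M (L1_norm K1) mK)).
    - rewrite -mulrBr normrM mulrCA ler_wpM2l//.
      exact: normr_convB_le.
  rewrite (RintegralZl _ measurableT (L1M (L1_norm K1) mK)).
  apply: (@le_trans _ _ ((B + 1) * d)).
    apply: ler_pM => //; last by rewrite lerDl.
    by apply: Rintegral_ge0 => y _; rewrite mulr_ge0 ?modulus_ge0.
  by rewrite (RintegralT_dilation N0 f1) /d mulrC divfK// lt0r_neq0.
have /vanishesP vK : vanishes (conv K (conv k g)).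
  have := vanishes_conv k1 (bounded_measurable_conv K1 bg) (v _ N0).
  by apply: le_vanishes => x; rewrite (conv_comm x k1 K1 bg).
have eC0 : 0 < e * fejer_mass R / 2 by rewrite divr_gt0 ?mulr_gt0.
apply: filterS (vK _ eC0) => x hx; rewrite -(ler_pM2l C0).
rewrite -{1}(gtr0_norm C0) -normrM.
rewrite -[X in `|X|](subrK (conv K (conv k g) x)).
apply: le_trans (ler_normD _ _) _.
by apply: le_trans (lerD (approx x) hx) _; rewrite -splitr mulrC.
Qed.

(** The target kernel [k] is real, so the conclusion splits by component; a complex target is
    handled by applying this to its real and imaginary parts. *)
Lemma wiener_tauberian p q g1 g2 k : L1 p -> L1 q ->
  bounded_measurable g1 -> bounded_measurable g2 ->
  vanishes (fun x => conv p g1 x - conv q g2 x) ->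
  vanishes (fun x => conv q g1 x + conv p g2 x) ->
  (forall c, 0 < (\int[mu]_y modulate_re c p q y) ^+ 2 + (\int[mu]_y modulate_im c p q y) ^+ 2) ->
  L1 k -> vanishes (conv k g1) /\ vanishes (conv k g2).
Proof.
move=> p1 q1 b1 b2 v1 v2 ab0 k1.
have all (l : R) (l0 : 0 < l) := vanishes_conv_fejer_all p1 q1 b1 b2 v1 v2 ab0 l0.
by split; apply: vanishes_conv_of_fejer => // l /all[].
Qed.

End WienerTheorem.

(** * Translation of the two summability methods into convolutions *)

Section SummabilityMethods.
Variable R : realType.
Local Notation mu := (@lebesgue_measure R).
Local Notation Re := complex.Re.
Local Notation Im := complex.Im.
Implicit Types (phi f g : R -> R[i]).

Lemma measurable_Rplus : measurable (@Rplus R).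
Proof. exact: measurable_itv. Qed.

Lemma mem_Rplus (x : R) : (x \in @Rplus R) = (0 <= x).
Proof.
by apply/idP/idP; rewrite inE /Rplus /= in_itv /= andbT.
Qed.

Lemma CL1_ext0 phi : CL1 (@Rplus R) phi ->
  L1 (fun x => Re (ext0 phi x)) /\ L1 (fun x => Im (ext0 phi x)).
Proof.
move=> [h1 h2]; split.
- have := (integrable_mkcond (mu := mu) _ measurable_Rplus).1 h1.
  congr (integrable _ _ _); apply/funext => x.
  by rewrite /ext0 patchE mem_Rplus /=; case: ifP.
- have := (integrable_mkcond (mu := mu) _ measurable_Rplus).1 h2.
  congr (integrable _ _ _); apply/funext => x.
  by rewrite /ext0 patchE mem_Rplus /=; case: ifP.
Qed.

Lemma RintegralT_ext0 phi :
  \int[mu]_x Re (ext0 phi x) = Re (Cintegral (@Rplus R) phi) /\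
  \int[mu]_x Im (ext0 phi x) = Im (Cintegral (@Rplus R) phi).
Proof.
rewrite /Cintegral /=; split; rewrite [RHS]Rintegral_mkcond; apply: eq_Rintegral => x _.
  by rewrite /ext0 patchE mem_Rplus /=; case: ifP.
by rewrite /ext0 patchE mem_Rplus /=; case: ifP.
Qed.

Lemma fourier_modulate phi (c : R) : fourier phi c = Complex
  (\int[mu]_x modulate_re c (fun x => Re (phi x)) (fun x => Im (phi x)) x)
  (\int[mu]_x modulate_im c (fun x => Re (phi x)) (fun x => Im (phi x)) x).
Proof.
rewrite /fourier /Cintegral; congr Complex; apply: eq_Rintegral => x _.
  by rewrite /modulate_re; case: (phi x) => u v /=; ring.
by rewrite /modulate_im; case: (phi x) => u v /=; ring.
Qed.

Lemma cmod_ge (z : R[i]) : `|Re z| <= cmod z /\ `|Im z| <= cmod z.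
Proof.
rewrite /cmod; split; rewrite -sqrtr_sqr ler_wsqrtr//.
  by rewrite lerDl sqr_ge0.
by rewrite lerDr sqr_ge0.
Qed.

Lemma cmod_le (z : R[i]) : cmod z <= `|Re z| + `|Im z|.
Proof.
rewrite /cmod -[leRHS]ger0_norm ?addr_ge0// -sqrtr_sqr ler_wsqrtr//.
rewrite sqrrD !real_normK ?num_real// -addrA lerD2l lerDr.
by rewrite mulrn_wge0// mulr_ge0.
Qed.

(** Replacing by 0 the values that exceed the essential bound keeps measurability and alters [f]
    only on a null set. The cut is at [|M|], so that the value 0 respects it whatever the sign of
    [M]. *)
Lemma CLinf_bounded f : CLinf (@Rplus R) f -> exists f1 f2 : R -> R,
  [/\ bounded_measurable f1, bounded_measurable f2,
      (forall t, t < 0 -> f1 t = 0 /\ f2 t = 0) &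
      {ae mu, forall t, 0 <= t -> f1 t = Re (f t) /\ f2 t = Im (f t)}].
Proof.
move=> [m1 [m2 [M fM]]].
pose f1 t := if (0 <= t) && (`|Re (f t)| <= `|M|) then Re (f t) else 0.
pose f2 t := if (0 <= t) && (`|Im (f t)| <= `|M|) then Im (f t) else 0.
have cut (h : R -> R) : measurable_fun (@Rplus R) h ->
    bounded_measurable (fun t => if (0 <= t) && (`|h t| <= `|M|) then h t else 0).
  move=> mh; split; last first.
    by exists `|M| => t; case: ifP => [/andP[_ //]|_]; rewrite normr0.
  have mh' : measurable_fun setT (h \_ (@Rplus R)).
    exact/(measurable_restrictT _ measurable_Rplus).
  rewrite (_ : (fun t => _) = (fun t => if `|(h \_ (@Rplus R)) t| <= `|M|
      then (h \_ (@Rplus R)) t else 0)); last first.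
    apply/funext => t; rewrite patchE mem_Rplus.
    by case: (0 <= t) => //=; case: ifP.
  apply: measurable_fun_ifT => //.
  by apply: measurable_fun_ler => //; exact: measurableT_comp.
exists f1, f2; split; [exact: cut|exact: cut| |].
  by move=> t t0; rewrite /f1 /f2 leNgt t0.
apply: (@filterS _ _ (ae_filter_ringOfSetsType mu)) fM => t h t0.
have /h : @Rplus R t by rewrite /Rplus /= in_itv /= t0.
have [h1 h2] := cmod_ge (f t) => fM.
rewrite /f1 /f2 t0 /= !ifT//.
  by rewrite (le_trans h2)// (le_trans fM)// ler_norm.
by rewrite (le_trans h1)// (le_trans fM)// ler_norm.
Qed.

Lemma Ccvg_pinftyP (S : R -> R[i]) (alpha : R[i]) : Ccvg_pinfty S alpha <->
  vanishes (fun x => Re (S x) - Re alpha) /\ vanishes (fun x => Im (S x) - Im alpha).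
Proof.
have ReB (z w : R[i]) : Re (z - w) = Re z - Re w by case: z => ? ?; case: w.
have ImB (z w : R[i]) : Im (z - w) = Im z - Im w by case: z => ? ?; case: w.
split => [S_alpha|[/vanishesP h1 /vanishesP h2] e e0].
  split; apply/vanishesP => e e0; apply/near_pinftyP.
  - have [M hM] := S_alpha e e0; exists M => x /hM /ltW; rewrite -ReB.
    by apply: le_trans; have [] := cmod_ge (S x - alpha).
  - have [M hM] := S_alpha e e0; exists M => x /hM /ltW; rewrite -ImB.
    by apply: le_trans; have [] := cmod_ge (S x - alpha).
(* Two components of size at most [e / 3] leave room for the strict inequality. *)
have e3 : 0 < e / 3 by rewrite divr_gt0.
apply/near_pinftyP; apply: filterS2 (h1 _ e3) (h2 _ e3) => x {}h1 {}h2.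
apply: le_lt_trans (cmod_le _) _; rewrite ReB ImB; lra.
Qed.

Lemma eq_Ccvg_pinfty (S T : R -> R[i]) (alpha : R[i]) :
  (forall x, 0 <= x -> S x = T x) -> Ccvg_pinfty S alpha <-> Ccvg_pinfty T alpha.
Proof.
move=> ST; split => h e /h[M hM]; exists (Num.max M 0) => x; rewrite gt_max => /andP[Mx x0].
  by rewrite -ST ?ltW//; exact: hM.
by rewrite ST ?ltW//; exact: hM.
Qed.

Definition Cconv (Phi F : R -> R[i]) (x : R) : R[i] :=
  Cintegral setT (fun t => F t * Phi (x - t)).

Lemma Cintegral_mkcond (D : set R) (F G : R -> R[i]) :
  (forall t, G t = if t \in D then F t else 0) -> Cintegral D F = Cintegral setT G.
Proof.
move=> GE; rewrite /Cintegral; congr Complex; rewrite Rintegral_mkcond;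
  by apply: eq_Rintegral => t _; rewrite patchE GE; case: ifP.
Qed.

Lemma Sphi_Cconv phi f x : Sphi phi f x = Cconv (ext0 phi) (ext0 f) x.
Proof.
apply: Cintegral_mkcond => t; rewrite /ext0 subr_ge0.
have -> : (t \in `[0, x]%classic) = (0 <= t <= x).
  by apply/idP/idP; rewrite inE /= in_itv.
by case: (0 <= t) => /=; case: (t <= x); rewrite ?mul0r ?mulr0.
Qed.

(** For negative [x] the left integral would also see [f] at negative arguments, where [ext0 f] is
    0; the limits only concern large [x]. *)
Lemma Sphistar_Cconv phi f x : 0 <= x ->
  Sphistar phi f x = Cconv (fun y => ext0 phi (- y)) (ext0 f) x.
Proof.
move=> x0; apply: Cintegral_mkcond => t; rewrite /ext0 opprB subr_ge0.
have -> : (t \in `[x, +oo[%classic) = (x <= t).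
  by apply/idP/idP; rewrite inE /= in_itv /= andbT.
have [xt|xt] := leP x t; last by rewrite mulr0.
by rewrite (le_trans x0 xt).
Qed.

Lemma measurable_ext0 f : CLinf (@Rplus R) f ->
  measurable_fun setT (fun t => Re (ext0 f t)) /\ measurable_fun setT (fun t => Im (ext0 f t)).
Proof.
move=> [m1 [m2 _]]; split.
- have := (measurable_restrictT _ measurable_Rplus).1 m1.
  congr (measurable_fun _ _); apply/funext => x.
  by rewrite /ext0 patchE mem_Rplus /=; case: ifP.
- have := (measurable_restrictT _ measurable_Rplus).1 m2.
  congr (measurable_fun _ _); apply/funext => x.
  by rewrite /ext0 patchE mem_Rplus /=; case: ifP.
Qed.

(** Passing to the bounded representatives changes the integrand only on a null set, so the equality
    holds at every [x]. *)
Lemma CconvE (Phi f : R -> R[i]) (f1 f2 : R -> R) x :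
  let p := fun y => Re (Phi y) in let q := fun y => Im (Phi y) in
  L1 p -> L1 q -> CLinf (@Rplus R) f ->
  bounded_measurable f1 -> bounded_measurable f2 ->
  (forall t, t < 0 -> f1 t = 0 /\ f2 t = 0) ->
  {ae mu, forall t, 0 <= t -> f1 t = Re (f t) /\ f2 t = Im (f t)} ->
  Cconv Phi (ext0 f) x = Complex (conv p f1 x - conv q f2 x) (conv q f1 x + conv p f2 x).
Proof.
move=> p q p1 q1 /measurable_ext0[mf1 mf2] b1 b2 f0 fae.
have px : L1 (fun t => p (x - t)) by exact: L1_reflect.
have qx : L1 (fun t => q (x - t)) by exact: L1_reflect.
have mpx := L1_measurable px; have mqx := L1_measurable qx.
have fae' : {ae mu, forall t, f1 t = Re (ext0 f t) /\ f2 t = Im (ext0 f t)}.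
  apply: (@filterS _ _ (ae_filter_ringOfSetsType mu)) fae => t h.
  by rewrite /ext0; have [/h//|/f0] := leP 0 t.
rewrite !convE//; congr Complex.
- rewrite -(RintegralB measurableT (L1M px b1) (L1M qx b2)).
  rewrite /Cintegral; apply: RintegralT_ae_eq.
  + apply: (@filterS _ _ (ae_filter_ringOfSetsType mu)) fae' => t [-> ->].
    by rewrite /p /q; case: (ext0 f t) => ? ?; case: (Phi (x - t)) => ? ? /=; ring.
  + rewrite (_ : (fun t => _) = (fun t => Re (ext0 f t) * p (x - t) - Im (ext0 f t) * q (x - t))).
      by apply: measurable_funB; exact: measurable_funM.
    apply/funext => t; rewrite /p /q.
    by case: (ext0 f t) => ? ?; case: (Phi (x - t)).
  + exact: (L1_measurable (L1B (L1M px b1) (L1M qx b2))).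
- rewrite -(RintegralD measurableT (L1M qx b1) (L1M px b2)).
  rewrite /Cintegral; apply: RintegralT_ae_eq.
  + apply: (@filterS _ _ (ae_filter_ringOfSetsType mu)) fae' => t [-> ->].
    by rewrite /p /q; case: (ext0 f t) => ? ?; case: (Phi (x - t)) => ? ? /=; ring.
  + rewrite (_ : (fun t => _) = (fun t => Re (ext0 f t) * q (x - t) + Im (ext0 f t) * p (x - t))).
      by apply: measurable_funD; exact: measurable_funM.
    apply/funext => t; rewrite /p /q.
    by case: (ext0 f t) => ? ?; case: (Phi (x - t)) => ? ? /=; ring.
  + exact: (L1_measurable (L1D (L1M qx b1) (L1M px b2))).
Qed.

Lemma conv_cst (k : R -> R) (c x : R) : L1 k -> conv k (cst c) x = (\int[mu]_y k y) * c.
Proof. by move=> k1; rewrite /conv RintegralZr. Qed.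

(** Both kernels have mass 1, so they map the constant [alpha] to itself and both limits concern the
    same function [f - alpha]. Stated for two arbitrary kernels, it yields both directions of the
    equivalence. *)
Lemma Ccvg_pinfty_Cconv (Phi Psi f : R -> R[i]) (alpha : R[i]) :
  L1 (fun y => Re (Phi y)) -> L1 (fun y => Im (Phi y)) ->
  \int[mu]_y Re (Phi y) = 1 -> \int[mu]_y Im (Phi y) = 0 ->
  L1 (fun y => Re (Psi y)) -> L1 (fun y => Im (Psi y)) ->
  \int[mu]_y Re (Psi y) = 1 -> \int[mu]_y Im (Psi y) = 0 ->
  (forall c, fourier Phi c <> 0) -> CLinf (@Rplus R) f ->
  Ccvg_pinfty (Cconv Phi (ext0 f)) alpha -> Ccvg_pinfty (Cconv Psi (ext0 f)) alpha.
Proof.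
move=> p1 q1 ip iq p1' q1' ip' iq' F0 fb.
have [f1 [f2 [b1 b2 f0 fae]]] := CLinf_bounded fb.
have bR := bounded_measurable_cst (Re alpha); have bI := bounded_measurable_cst (Im alpha).
have bg1 := bounded_measurableB b1 bR; have bg2 := bounded_measurableB b2 bI.
have reE (u v : R -> R) : L1 u -> L1 v -> \int[mu]_y u y = 1 -> \int[mu]_y v y = 0 ->
    (fun x => conv u f1 x - conv v f2 x - Re alpha) =
    (fun x => conv u (fun t => f1 t - Re alpha) x - conv v (fun t => f2 t - Im alpha) x).
  move=> u1 v1 iu iv; apply/funext => x.
  rewrite (convBr x u1 b1 bR) (convBr x v1 b2 bI) !conv_cst// iu iv; ring.
have imE (u v : R -> R) : L1 u -> L1 v -> \int[mu]_y u y = 1 -> \int[mu]_y v y = 0 ->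
    (fun x => conv v f1 x + conv u f2 x - Im alpha) =
    (fun x => conv v (fun t => f1 t - Re alpha) x + conv u (fun t => f2 t - Im alpha) x).
  move=> u1 v1 iu iv; apply/funext => x.
  rewrite (convBr x v1 b1 bR) (convBr x u1 b2 bI) !conv_cst// iu iv; ring.
have PhiE := funext (fun x => CconvE x p1 q1 fb b1 b2 f0 fae).
have PsiE := funext (fun x => CconvE x p1' q1' fb b1 b2 f0 fae).
move=> /Ccvg_pinftyP; rewrite PhiE /= reE// imE// => -[v1 v2].
apply/Ccvg_pinftyP; rewrite PsiE /= reE// imE//.
have ft c : 0 < (\int[mu]_y modulate_re c (fun y => Re (Phi y)) (fun y => Im (Phi y)) y) ^+ 2 +
    (\int[mu]_y modulate_im c (fun y => Re (Phi y)) (fun y => Im (Phi y)) y) ^+ 2.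
  have /eqP := F0 c; rewrite fourier_modulate lt0r addr_ge0 ?sqr_ge0// andbT.
  by apply: contra; rewrite paddr_eq0 ?sqr_ge0// !sqrf_eq0 => /andP[/eqP -> /eqP ->].
have [w1 w2] := wiener_tauberian p1 q1 bg1 bg2 v1 v2 ft p1'.
have [w3 w4] := wiener_tauberian p1 q1 bg1 bg2 v1 v2 ft q1'.
by split; [exact: vanishesB|exact: vanishesD].
Qed.

(** The substitution [y] to [- y] reflects the zero set of the transform, so an empty zero set stays
    empty and the reflected kernel is admissible as a source too. *)
Lemma fourier_reflect (Phi : R -> R[i]) c :
  L1 (fun y => Re (Phi y)) -> L1 (fun y => Im (Phi y)) ->
  fourier (fun y => Phi (- y)) c = fourier Phi (- c).
Proof.
move=> p1 q1; rewrite !fourier_modulate.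
congr Complex.
- rewrite -(RintegralT_reflect 0 (L1_modulate_re (- c) p1 q1)).
  by apply: eq_Rintegral => y _; rewrite /modulate_re sub0r mulrNN.
- rewrite -(RintegralT_reflect 0 (L1_modulate_im (- c) p1 q1)).
  by apply: eq_Rintegral => y _; rewrite /modulate_im sub0r mulrNN.
Qed.

End SummabilityMethods.

Theorem theorem4p3 (R : realType) (phi : R -> R[i]) :
  CL1 (@Rplus R) phi ->
  Cintegral (@Rplus R) phi = 1 ->
  Zset (ext0 phi) = set0 ->
  forall (f : R -> R[i]), CLinf (@Rplus R) f ->
  forall alpha : R[i],
    Ccvg_pinfty (Sphi phi f) alpha <-> Ccvg_pinfty (Sphistar phi f) alpha.
Proof.
move=> phi1 phi_mass phi_zset f fb alpha.
have [p1 q1] := CL1_ext0 phi1.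
have [ip iq] := RintegralT_ext0 phi; rewrite phi_mass /= in ip iq.
have F0 c : fourier (ext0 phi) c <> 0.
  by move=> Fc; have : Zset (ext0 phi) c by []; rewrite phi_zset.
have refl (k : R -> R) : L1 k -> L1 (fun y => k (- y)) /\
    \int[@lebesgue_measure R]_y k (- y) = \int[@lebesgue_measure R]_y k y.
  move=> k1; rewrite -(RintegralT_reflect 0 k1); split.
    by apply: eq_L1 (L1_reflect 0 k1) => y; rewrite sub0r.
  by apply: eq_Rintegral => y _; rewrite sub0r.
have [p1' ip'] := refl _ p1; have [q1' iq'] := refl _ q1.
rewrite ip in ip'; rewrite iq in iq'.
have F0' c : fourier (fun y => ext0 phi (- y)) c <> 0 by rewrite fourier_reflect.
have SE x : 0 <= x -> Sphi phi f x = Cconv (ext0 phi) (ext0 f) x.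
  by move=> _; exact: Sphi_Cconv.
rewrite (eq_Ccvg_pinfty _ SE) (eq_Ccvg_pinfty _ (fun x => @Sphistar_Cconv _ phi f x)).
split.
- exact: (Ccvg_pinfty_Cconv p1 q1 ip iq p1' q1' ip' iq' F0 fb).
- exact: (Ccvg_pinfty_Cconv p1' q1' ip' iq' p1 q1 ip iq F0' fb).
Qed.
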